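(* Let $\beta,\lambda>0$, and let $\Gamma\subset\mathbb R$ be a separated set with lower Beurling density $D^-(\Gamma)>2\beta^{-1}$. Let $f(x)=\sum_{k\in\mathbb Z}c_ke^{-\lambda(x-\beta k)^2}$ with $\{c_k\}\in\ell^\infty(\mathbb Z)$ and $\{kc_k\}\in\ell^\infty(\mathbb Z)$. Then $f$ is uniquely determined, up to a unimodular constant and conjugation, by its phaseless Hermite samples $|f(\gamma)|,|f'(\gamma)|$, $\gamma\in\Gamma$: that is, if $g(x)=\sum_{k\in\mathbb Z}d_ke^{-\lambda(x-\beta k)^2}$ with $\{d_k\}\in\ell^\infty(\mathbb Z)$, $\{kd_k\}\in\ell^\infty(\mathbb Z)$ satisfies $|g(\gamma)|=|f(\gamma)|$ and $|g'(\gamma)|=|f'(\gamma)|$ for all $\gamma\in\Gamma$, then there is $z\in\mathbb C$ with $|z|=1$ such that $g=zf$ or $g=z\overline{f}$.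
   Context: A set $\Gamma\subset\mathbb R$ is separated if $\inf\{|\gamma-\gamma'|:\gamma\neq\gamma'\in\Gamma\}>0$. The lower Beurling density is $D^-(\Gamma)=\liminf_{r\to\infty}\inf_{x\in\mathbb R}\frac{\#(\Gamma\cap[x-r,x+r])}{2r}$. *)

(* Defs.v *)
From Stdlib Require Import Reals ZArith List.
From Coquelicot Require Import Coquelicot.
Open Scope R_scope.

Definition separated (Gamma : R -> Prop) : Prop :=
  exists delta : R, 0 < delta /\
    forall g g' : R, Gamma g -> Gamma g' -> g <> g' -> delta <= Rabs (g - g').

(* #(Gamma ∩ [x - r, x + r]) as an extended real: the supremum of the
   lengths of duplicate-free lists of points of Gamma ∩ [x-r, x+r]. *)
Definition count_in (Gamma : R -> Prop) (x r : R) : Rbar :=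
  Rbar_lub (fun t : Rbar => exists l : list R,
    NoDup l /\ List.Forall (fun y => Gamma y /\ x - r <= y <= x + r) l /\
    t = Finite (INR (length l))).

Definition inf_count_ratio (Gamma : R -> Prop) (r : R) : Rbar :=
  Rbar_glb (fun t : Rbar => exists x : R,
    t = Rbar_mult (count_in Gamma x r) (Finite (/ (2 * r)))).

(* D^-(Gamma) = liminf_{r -> oo} inf_x #(Gamma ∩ [x-r,x+r]) / (2r)
             = sup_{r0} inf_{r >= r0} (...) (r0 ranging over positive reals). *)
Definition lower_beurling_density (Gamma : R -> Prop) : Rbar :=
  Rbar_lub (fun t : Rbar => exists r0 : R, 0 < r0 /\
    t = Rbar_glb (fun s : Rbar => exists r : R, r0 <= r /\ s = inf_count_ratio Gamma r)).

Definition bounded_seq (c : Z -> C) : Prop :=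
  exists M : R, forall k : Z, Cmod (c k) <= M.

(* Sum over Z (for absolutely summable families): limit of the symmetric
   partial sums sum_{k=-N}^{N} a_k, taken componentwise. *)
Definition sym_partial (a : Z -> R) (N : nat) : R :=
  sum_n (fun n : nat =>
    if Nat.eqb n 0 then a 0%Z else a (Z.of_nat n) + a (- Z.of_nat n)%Z) N.

Definition Zsum (a : Z -> C) : C :=
  (real (Lim_seq (sym_partial (fun k => fst (a k)))),
   real (Lim_seq (sym_partial (fun k => snd (a k))))).

Definition gauss_series (lambda beta : R) (c : Z -> C) (x : R) : C :=
  Zsum (fun k : Z => Cmult (RtoC (exp (- lambda * (x - beta * IZR k) ^ 2))) (c k)).

Definition Cderive (f : R -> C) (x : R) : C :=
  (Derive (fun t => fst (f t)) x, Derive (fun t => snd (f t)) x).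

(* Main.v *)
(* Everything is real and elementary; the idea is a quantitative form of
   "too many zeros force a function to vanish".  In w = exp (2 mu al x) a series
   sum a_n exp (- mu (x - al n)^2) is, up to a positive factor, a Laurent series
   sum a_n q^(n^2) w^n.  The divided difference at x0 and N zeros to the left of
   x0 kills a window of N exponents, and the remaining coefficients are so small
   that, when the zeros have density > 1/al, evaluation at x0 is a combination of
   evaluations at the zeros up to an error tending to 0 as N grows.

   Products of two Gaussian series of step beta are of this kind with mu = 2 lambda
   and al = beta/2.  Write f' = 2 lambda (beta h - x f) with h = sum k c_k exp(...),
   and similarly for g.  Then |f|^2 - |g|^2 vanishes on Gamma, hence everywhere;
   differentiating, Re (h conj f) is the same for f and g, so that
   |f'|^2 - |g'|^2 = (2 lambda beta)^2 (|h_f|^2 - |h_g|^2), which again vanishes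
   everywhere.  Hence Im (h_f conj f) = +- Im (h_g conj g) pointwise, and with one
   global sign because a product series vanishing on an interval is zero.  After
   possibly conjugating g, the quotient g/f is locally constant. *)

Require Import Defs.
From Stdlib Require Import Reals ZArith List Lra Lia FinFun Classical.
From Coquelicot Require Import Coquelicot.
Open Scope R_scope.

(** * Divided differences of monomials *)

(** The node [a] is kept apart from the list: it will carry the evaluation point, while the list
    carries the zeros. *)
Fixpoint divdiff (a : R) (l : list R) (f : R -> R) : R :=
  match l with
  | nil => f a
  | b :: l' => (divdiff a l' f - divdiff b l' f) / (a - b)
  end.

Lemma divdiff_ext (f g : R -> R) (l : list R) : forall a,
  (forall w, In w (a :: l) -> f w = g w) -> divdiff a l f = divdiff a l g.
Proof.
  induction l as [|b l IH]; intros a H; simpl in *; [now apply H; left|].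
  rewrite (IH a), (IH b); auto; intros w [Hw|Hw]; apply H; auto.
Qed.

Lemma divdiff_plus (f g : R -> R) (l : list R) : forall a,
  divdiff a l (fun w => f w + g w) = divdiff a l f + divdiff a l g.
Proof.
  induction l as [|b l IH]; intros a; simpl; [reflexivity|].
  rewrite (IH a), (IH b); unfold Rdiv; ring.
Qed.

Lemma divdiff_scal (c : R) (f : R -> R) (l : list R) : forall a,
  divdiff a l (fun w => c * f w) = c * divdiff a l f.
Proof.
  induction l as [|b l IH]; intros a; simpl; [reflexivity|].
  rewrite (IH a), (IH b); unfold Rdiv; ring.
Qed.

Lemma is_lim_seq_divdiff (f : nat -> R -> R) (g : R -> R) (l : list R) :
  (forall w, is_lim_seq (fun n => f n w) (g w)) ->
  forall a, is_lim_seq (fun n => divdiff a l (f n)) (divdiff a l g).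
Proof.
  intros H; induction l as [|b l IH]; intros a; simpl; [apply H|].
  unfold Rdiv; apply (is_lim_seq_scal_r _ _ (Finite _)).
  now apply is_lim_seq_minus'.
Qed.

(** Leibniz rule with two surviving terms, since the identity has no divided differences of order
    above one. In the induction the lower-order terms for [a] and [b] coincide and cancel. *)
Lemma divdiff_mul_id (f : R -> R) (l : list R) : forall a b,
  NoDup (a :: b :: l) ->
  divdiff a (b :: l) (fun w => w * f w) = a * divdiff a (b :: l) f + divdiff b l f.
Proof.
  destruct l as [|c l]; intros a b H.
  - assert (a <> b) by (inversion H; subst; simpl in *; intuition).
    simpl; field; lra.
  - revert a b c H; induction l as [|e l IH]; intros a b c H;
    (assert (Hab : a <> b) by (inversion H; subst; simpl in *; intuition));
    (assert (Hac : a <> c) by (inversion H; subst; simpl in *; intuition));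
    (assert (Hbc : b <> c) by (inversion H as [|? ? ? H']; inversion H'; subst; simpl in *; intuition)).
    + simpl; field; repeat split; lra.
    + assert (H1 : NoDup (a :: c :: e :: l))
        by (inversion H as [|? ? Ha H']; inversion H'; subst; constructor; simpl in *; intuition).
      assert (H2 : NoDup (b :: c :: e :: l)) by (now inversion H).
      change (divdiff a (b :: c :: e :: l) (fun w => w * f w)) with
        ((divdiff a (c :: e :: l) (fun w => w * f w)
          - divdiff b (c :: e :: l) (fun w => w * f w)) / (a - b)).
      change (divdiff a (b :: c :: e :: l) f) with
        ((divdiff a (c :: e :: l) f - divdiff b (c :: e :: l) f) / (a - b)).
      rewrite (IH a c e H1), (IH b c e H2).
      field; lra.
Qed.

Lemma divdiff_const (b : R) (l : list R) (c : R) : forall a,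
  divdiff a (b :: l) (fun _ => c) = 0.
Proof.
  revert b; induction l as [|e l IH]; intros b a.
  - simpl; unfold Rdiv; ring.
  - change (divdiff a (b :: e :: l) (fun _ => c)) with
      ((divdiff a (e :: l) (fun _ => c) - divdiff b (e :: l) (fun _ => c)) / (a - b)).
    rewrite !IH; unfold Rdiv; ring.
Qed.

(** The Leibniz rule lowers the degree either at the same order or together with the order. *)
Lemma divdiff_pow_small (l : list R) : forall a n,
  NoDup (a :: l) -> (n < length l)%nat -> divdiff a l (fun w => w ^ n) = 0.
Proof.
  induction l as [|b l IH]; intros a n H Hn; [inversion Hn|].
  revert Hn; induction n as [|n IHn]; intros Hn.
  - apply (divdiff_const b l 1).
  - change (fun w => w ^ S n) with (fun w : R => w * w ^ n).
    rewrite divdiff_mul_id, IHn, IH; auto; simpl in *; try lia; [ring|].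
    now inversion H.
Qed.

(* The divided differences of w^(N+j) are the complete homogeneous symmetric
   polynomials h_j of the nodes; those of w^(-1-j) are, up to sign,
   h_j(1/w) / prod w. *)
Lemma divdiff_pow_bound (l : list R) : forall a j,
  NoDup (a :: l) -> (forall w, In w (a :: l) -> 0 <= w <= 1) ->
  0 <= divdiff a l (fun w => w ^ (length l + j)) <= INR (S (length l)) ^ j.
Proof.
  induction l as [|b l IH]; intros a j H Hw.
  - simpl. rewrite pow1. split; [apply pow_le | rewrite <- (pow1 j); apply pow_incr];
    apply Hw; now left.
  - assert (Ha : 0 <= a <= 1) by (apply Hw; now left).
    assert (H' : NoDup (b :: l)) by now inversion H.
    assert (Hw' : forall w, In w (b :: l) -> 0 <= w <= 1) by (intros; apply Hw; now right).
    (* On homogeneous polynomials this reads h_(j+1)(a, b, ...) = a h_j(a, b, ...) + h_(j+1)(b,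
       ...). The induction runs on the nodes and, inside, on j. *)
    assert (E : forall m, divdiff a (b :: l) (fun w => w ^ S m) =
       a * divdiff a (b :: l) (fun w => w ^ m) + divdiff b l (fun w => w ^ m)).
    { intros m. change (fun w => w ^ S m) with (fun w : R => w * w ^ m).
      now apply divdiff_mul_id. }
    induction j as [|j IHj].
    + replace (length (b :: l) + 0)%nat with (S (length l + 0)) by (simpl; lia).
      rewrite E, divdiff_pow_small; [|auto|simpl; lia].
      generalize (IH b 0%nat H' Hw'); simpl pow; lra.
    + replace (length (b :: l) + S j)%nat with (S (length (b :: l) + j)) by lia.
      rewrite E. generalize (IH b (S j) H' Hw').
      replace (length l + S j)%nat with (length (b :: l) + j)%nat by (simpl; lia).
      set (u := divdiff a (b :: l) _) in *. set (v := divdiff b l _).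
      change (length (b :: l)) with (S (length l)) in *.
      rewrite (S_INR (S (length l))) in *.
      set (m := INR (S (length l))) in *.
      assert (Hm : 0 <= m) by apply pos_INR.
      intros Hv. assert (Hu : 0 <= a * u <= (m + 1) ^ j) by nra.
      split; [lra|].
      assert (m ^ j <= (m + 1) ^ j) by (apply pow_incr; lra).
      simpl in Hv |- *. nra.
Qed.

Definition prodR (l : list R) : R := fold_right Rmult 1 l.

Lemma prodR_pos (l : list R) : (forall w, In w l -> 0 < w) -> 0 < prodR l.
Proof.
  induction l as [|b l IH]; simpl; intros H; [lra|].
  apply Rmult_lt_0_compat; [apply H; now left | apply IH; auto].
Qed.

Lemma divdiff_inv_pow_bound (V : R) (l : list R) : 0 < V -> forall a j,
  NoDup (a :: l) -> (forall w, In w (a :: l) -> V <= w) ->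
  Rabs (divdiff a l (fun w => / w ^ S j))
    <= (INR (S (length l)) / V) ^ j / prodR (a :: l).
Proof.
  intros HV; induction l as [|b l IH]; intros a j H Hw.
  - assert (Ha : V <= a) by (apply Hw; now left).
    assert (0 < a ^ j) by (apply pow_lt; lra).
    simpl. replace (1 / V) with (/ V) by (field; lra).
    rewrite Rabs_pos_eq by (left; apply Rinv_0_lt_compat; nra).
    rewrite Rmult_1_r, Rinv_mult, Rmult_comm.
    apply Rmult_le_compat_r; [left; apply Rinv_0_lt_compat; lra|].
    rewrite <- pow_inv. apply pow_incr. split.
    + left; apply Rinv_0_lt_compat; lra.
    + apply Rinv_le_contravar; lra.
  - assert (Ha : V <= a) by (apply Hw; now left).
    assert (H' : NoDup (b :: l)) by now inversion H.
    assert (Hw' : forall w, In w (b :: l) -> V <= w) by (intros; apply Hw; now right).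
    assert (HP : 0 < prodR (b :: l)) by (apply prodR_pos; intros w Hin; specialize (Hw' w Hin); lra).
    (* The Leibniz rule for w * w^(-m-1), solved for the more negative exponent. Dividing by [a]
       supplies the new factor of the product of nodes. *)
    assert (E : forall m, a * divdiff a (b :: l) (fun w => / w ^ S m) =
       divdiff a (b :: l) (fun w => / w ^ m) - divdiff b l (fun w => / w ^ S m)).
    { intros m. rewrite <- (divdiff_ext (fun w => w * / w ^ S m) (fun w => / w ^ m)).
      - rewrite divdiff_mul_id by assumption. ring.
      - intros w Hin. specialize (Hw w Hin). simpl. field. split; [|lra].
        apply pow_nonzero; lra. }
    set (P := prodR (b :: l)) in *.
    change (prodR (a :: b :: l)) with (a * P).
    set (m := INR (S (length l))) in *.
    assert (Hm : 0 <= m) by apply pos_INR.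
    change (length (b :: l)) with (S (length l)). rewrite (S_INR (S (length l))). fold m.
    assert (G : forall u B, Rabs (a * u) <= B / P -> Rabs u <= B / (a * P)).
    { intros u B Hu. rewrite Rabs_mult, (Rabs_pos_eq a) in Hu by lra.
      apply (Rmult_le_reg_l a); [lra|].
      replace (a * (B / (a * P))) with (B / P) by (field; lra). exact Hu. }
    assert (HVi : 0 < / V) by now apply Rinv_0_lt_compat.
    induction j as [|j IHj]; apply G; rewrite E.
    + rewrite (divdiff_ext _ (fun _ => 1)) by (intros; simpl; field).
      rewrite divdiff_const, Rminus_0_l, Rabs_Ropp.
      apply (IH b 0%nat H' Hw').
    + eapply Rle_trans; [apply Rabs_triang|]. rewrite Rabs_Ropp.
      eapply Rle_trans; [apply Rplus_le_compat; [apply IHj | apply (IH b (S j) H' Hw')]|].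
      fold P m.
      assert (Hp : 0 <= ((m + 1) / V) ^ j) by (apply pow_le; unfold Rdiv; nra).
      assert (Hq : (m / V) ^ j <= ((m + 1) / V) ^ j)
        by (apply pow_incr; unfold Rdiv; nra).
      assert (HPi : 0 < / P) by now apply Rinv_0_lt_compat.
      assert (Hai : / a <= / V) by (apply Rinv_le_contravar; lra).
      replace (((m + 1) / V) ^ j / (a * P)) with (((m + 1) / V) ^ j * / a * / P) by (field; lra).
      unfold Rdiv at 2 4. rewrite <- Rmult_plus_distr_r.
      apply Rmult_le_compat_r; [lra|].
      simpl pow. unfold Rdiv in *.
      assert (((m + 1) * / V) ^ j * / a <= ((m + 1) * / V) ^ j * / V) by (apply Rmult_le_compat_l; lra).
      assert (m * / V * (m * / V) ^ j <= m * / V * ((m + 1) * / V) ^ j)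
        by (apply Rmult_le_compat_l; [nra|lra]).
      lra.
Qed.

Lemma divdiff_zero (f : R -> R) (l : list R) : forall a,
  (forall w, In w (a :: l) -> f w = 0) -> divdiff a l f = 0.
Proof.
  intros a H. rewrite (divdiff_ext f (fun w => 0 * f w)).
  - rewrite divdiff_scal; ring.
  - intros w Hw; rewrite (H w Hw); ring.
Qed.

(** In Lagrange form only the term of the node [a] survives, with denominator the product of the a -
    w. *)
Lemma divdiff_isolated (f : R -> R) (l : list R) : forall a,
  ~ In a l -> (forall w, In w l -> f w = 0) ->
  prodR (map (fun w => a - w) l) * divdiff a l f = f a.
Proof.
  induction l as [|b l IH]; intros a Ha H.
  - simpl; ring.
  - change (divdiff a (b :: l) f) with ((divdiff a l f - divdiff b l f) / (a - b)).
    rewrite (divdiff_zero f l b H).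
    assert (a <> b) by (simpl in Ha; intuition).
    rewrite <- (IH a) by (simpl in *; auto).
    simpl. field. lra.
Qed.

(** * Gaussians as monomials *)

Definition gauss (mu al : R) (n : Z) (x : R) : R := exp (- mu * (x - al * IZR n) ^ 2).

(** The properties of finite combinations of point evaluations that are used. Continuity under
    pointwise limits lets [Phi] act term by term on a Gaussian series. *)
Definition ptwise_linear (Phi : (R -> R) -> R) : Prop :=
  (forall u v, (forall x, u x = v x) -> Phi u = Phi v) /\
  (forall u v, Phi (fun x => u x + v x) = Phi u + Phi v) /\
  (forall c u, Phi (fun x => c * u x) = c * Phi u) /\
  (forall (u : nat -> R -> R) (v : R -> R), (forall x, is_lim_seq (fun n => u n x) (v x)) ->
     is_lim_seq (fun n => Phi (u n)) (Phi v)).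

(* In the variable w = exp (2 mu al (x - x0)) the Gaussian centred at al n is,
   up to a positive factor independent of n, the monomial w^n; the factor
   w^(-p) selects which window of exponents is annihilated. *)
Definition gauss_divdiff (mu al x0 : R) (p : Z) (ws : list R) (u : R -> R) : R :=
  prodR (map (fun w => 1 - w) ws) *
  divdiff 1 ws (fun w =>
    let y := ln w / (2 * mu * al) in
    exp (mu * y ^ 2 + 2 * mu * y * x0 - IZR p * ln w) * u (x0 + y)).

Lemma gauss_divdiff_linear (mu al x0 : R) (p : Z) (ws : list R) :
  ptwise_linear (gauss_divdiff mu al x0 p ws).
Proof.
  unfold gauss_divdiff; repeat split.
  - intros u v H; f_equal; apply divdiff_ext; intros; cbv zeta; now rewrite H.
  - intros u v; rewrite <- Rmult_plus_distr_l, <- divdiff_plus; f_equal.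
    apply divdiff_ext; intros; cbv zeta; ring.
  - intros c u.
    rewrite (divdiff_ext _ (fun w => c *
      (let y := ln w / (2 * mu * al) in
       exp (mu * y ^ 2 + 2 * mu * y * x0 - IZR p * ln w) * u (x0 + y))))
      by (intros; cbv zeta; ring).
    rewrite divdiff_scal; ring.
  - intros u v H. apply (is_lim_seq_scal_l _ _ (Finite _)).
    apply (is_lim_seq_divdiff (fun n w => let y := ln w / (2 * mu * al) in
      exp (mu * y ^ 2 + 2 * mu * y * x0 - IZR p * ln w) * u n (x0 + y))).
    intros w; cbv zeta. apply (is_lim_seq_scal_l _ _ (Finite _)). apply H.
Qed.

(** The node w = 1 stands for x0; the exponential weight is 1 there and the leading product undoes
    the Lagrange denominator. *)
Lemma gauss_divdiff_isolated (mu al x0 : R) (p : Z) (ws : list R) (u : R -> R) :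
  ~ In 1 ws -> (forall w, In w ws -> u (x0 + ln w / (2 * mu * al)) = 0) ->
  gauss_divdiff mu al x0 p ws u = u x0.
Proof.
  intros H1 H; unfold gauss_divdiff. rewrite divdiff_isolated; auto.
  - cbv zeta. rewrite ln_1.
    replace (0 / (2 * mu * al)) with 0 by (unfold Rdiv; ring).
    rewrite Rplus_0_r.
    replace (mu * 0 ^ 2 + 2 * mu * 0 * x0 - IZR p * 0) with 0 by ring.
    rewrite exp_0; ring.
  - intros w Hw; cbv zeta; rewrite (H w Hw); ring.
Qed.

Lemma exp_INR_ln (w : R) (m : nat) : 0 < w -> exp (INR m * ln w) = w ^ m.
Proof. intros Hw. rewrite <- Rpower_pow by exact Hw. reflexivity. Qed.

Lemma prod_one_minus_bound (ws : list R) :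
  (forall w, In w ws -> 0 <= w <= 1) -> 0 <= prodR (map (fun w => 1 - w) ws) <= 1.
Proof.
  induction ws as [|b l IH]; simpl; intros H; [lra|].
  assert (0 <= b <= 1) by (apply H; now left).
  assert (0 <= prodR (map (fun w => 1 - w) l) <= 1) by (apply IH; auto).
  nra.
Qed.

Section Bounds.
Context (mu al x0 V : R) (p : Z) (ws : list R).
Hypotheses (Hmu : 0 < mu) (Hal : 0 < al) (HV : 0 < V <= 1)
  (Hws : forall w, In w ws -> V <= w < 1) (Hnd : NoDup ws).

Let Hnd1 : NoDup (1 :: ws).
Proof. constructor; auto. intros H; apply Hws in H; lra. Qed.

(** With 2 mu al y = ln w, the exponent mu y^2 + 2 mu y x0 - mu (x0 + y - al n)^2 equals - mu (x0 -
    al n)^2 + n ln w. The constant c is the product of the 1 - w, of which only the range matters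
    below. *)
Lemma gauss_divdiff_monomial (n : Z) :
  exists c, 0 <= c <= 1 /\
  gauss_divdiff mu al x0 p ws (gauss mu al n) =
  gauss mu al n x0 * (c * divdiff 1 ws (fun w => exp (IZR (n - p) * ln w))).
Proof.
  exists (prodR (map (fun w => 1 - w) ws)). split.
  { apply prod_one_minus_bound; intros w Hw; apply Hws in Hw; lra. }
  unfold gauss_divdiff.
  rewrite (divdiff_ext _ (fun w => gauss mu al n x0 * exp (IZR (n - p) * ln w))).
  - rewrite divdiff_scal; ring.
  - intros w _; cbv zeta. unfold gauss. rewrite <- !exp_plus. f_equal.
    rewrite minus_IZR. field. lra.
Qed.

Lemma gauss_divdiff_middle (n : Z) :
  (p <= n < p + Z.of_nat (length ws))%Z ->
  gauss_divdiff mu al x0 p ws (gauss mu al n) = 0.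
Proof.
  intros Hn. destruct (gauss_divdiff_monomial n) as [c [_ E]]. rewrite E.
  rewrite (divdiff_ext _ (fun w => w ^ Z.to_nat (n - p))).
  - rewrite divdiff_pow_small; auto; [ring|lia].
  - intros w [Hw|Hw]; [|apply Hws in Hw]; rewrite <- exp_INR_ln by lra;
    rewrite INR_IZR_INZ, Z2Nat.id by lia; reflexivity.
Qed.

Lemma gauss_divdiff_upper (j : nat) :
  let n := (p + Z.of_nat (length ws) + Z.of_nat j)%Z in
  Rabs (gauss_divdiff mu al x0 p ws (gauss mu al n))
    <= gauss mu al n x0 * INR (S (length ws)) ^ j.
Proof.
  intros n. destruct (gauss_divdiff_monomial n) as [c [Hc E]]. rewrite E.
  assert (Hg : 0 < gauss mu al n x0) by apply exp_pos.
  rewrite Rabs_mult, (Rabs_pos_eq (gauss _ _ _ _)) by lra.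
  apply Rmult_le_compat_l; [lra|].
  rewrite (divdiff_ext _ (fun w => w ^ (length ws + j))).
  - assert (H := divdiff_pow_bound ws 1 j Hnd1).
    destruct H as [H1 H2].
    { intros w [Hw|Hw]; [|apply Hws in Hw]; lra. }
    rewrite Rabs_pos_eq by nra. nra.
  - intros w [Hw|Hw]; [|apply Hws in Hw]; rewrite <- exp_INR_ln by lra;
    rewrite INR_IZR_INZ; do 3 f_equal; unfold n; lia.
Qed.

Lemma gauss_divdiff_lower (j : nat) :
  let n := (p - 1 - Z.of_nat j)%Z in
  Rabs (gauss_divdiff mu al x0 p ws (gauss mu al n))
    <= gauss mu al n x0 * ((INR (S (length ws)) / V) ^ j / prodR ws).
Proof.
  intros n. destruct (gauss_divdiff_monomial n) as [c [Hc E]]. rewrite E.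
  assert (Hg : 0 < gauss mu al n x0) by apply exp_pos.
  rewrite Rabs_mult, (Rabs_pos_eq (gauss _ _ _ _)) by lra.
  apply Rmult_le_compat_l; [lra|].
  rewrite (divdiff_ext _ (fun w => / w ^ S j)).
  - assert (H : Rabs (divdiff 1 ws (fun w => / w ^ S j))
        <= (INR (S (length ws)) / V) ^ j / prodR (1 :: ws)).
    { apply divdiff_inv_pow_bound; auto; [lra|].
      intros w [Hw|Hw]; [|apply Hws in Hw]; lra. }
    simpl prodR in H. rewrite Rmult_1_l in H. fold (prodR ws) in H.
    rewrite Rabs_mult, (Rabs_pos_eq c) by lra.
    assert (H0 := Rabs_pos (divdiff 1 ws (fun w => / w ^ S j))).
    nra.
  - intros w [Hw|Hw]; [|apply Hws in Hw]; rewrite <- exp_INR_ln by lra;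
    rewrite INR_IZR_INZ, <- exp_Ropp; f_equal; rewrite Ropp_mult_distr_l, <- opp_IZR; do 2 f_equal; unfold n; lia.
Qed.
End Bounds.

(** * Approximate evaluation from points on the left *)

Lemma pow_exp (x : R) (n : nat) : exp x ^ n = exp (INR n * x).
Proof. rewrite <- exp_INR_ln by apply exp_pos. now rewrite ln_exp. Qed.

Lemma exp_le (x y : R) : x <= y -> exp x <= exp y.
Proof. intros [H|<-]; [left; now apply exp_increasing|apply Rle_refl]. Qed.

Definition sum_dist (x0 : R) (xs : list R) : R :=
  fold_right (fun x s => (x0 - x) + s) 0 xs.

(* The last bound is what K points in each of the B successive intervals of
   length l to the left of x0 provide; the density of the points exceeds 1/al. *)
Definition rich_left (al : R) (G : R -> Prop) (x0 : R) : Prop :=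
  exists (K B0 : nat) (l : R), 0 < l < al * INR K /\
  forall B, (B0 <= B)%nat -> exists xs : list R,
    length xs = (B * K)%nat /\ NoDup xs /\
    (forall x, In x xs -> G x /\ x0 - l * INR B <= x < x0) /\
    sum_dist x0 xs <= INR K * l * INR B * (INR B + 1) / 2.

Lemma quadratic_dominates (a c d : R) : 0 < a ->
  exists b0, forall b, b0 <= b -> c * b + d <= a * b ^ 2.
Proof.
  intros Ha. exists (Rmax 1 ((Rabs c + Rabs d) / a)). intros b Hb.
  assert (H1 : 1 <= b) by (eapply Rle_trans; [apply Rmax_l|exact Hb]).
  assert (H2 : (Rabs c + Rabs d) / a <= b) by (eapply Rle_trans; [apply Rmax_r|exact Hb]).
  assert (H3 : Rabs c + Rabs d <= a * b).
  { apply (Rmult_le_compat_l a) in H2; [|lra].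
    replace (a * ((Rabs c + Rabs d) / a)) with (Rabs c + Rabs d) in H2 by (field; lra). lra. }
  assert (Hc := Rle_abs c). assert (Hd := Rle_abs d). assert (Hd' := Rabs_pos d).
  nra.
Qed.

Lemma exp_dominates_affine (eta c : R) : 0 < eta ->
  exists b0, forall b, b0 <= b -> c * b + 1 <= exp (eta * b).
Proof.
  (* The coefficient eta^2 / 4 is that of b^2 in (1 + eta b / 2)^2, a lower bound of exp (eta b). *)
  intros He. destruct (quadratic_dominates (eta ^ 2 / 4) c 1) as [b0 H]; [nra|].
  exists (Rmax 0 b0). intros b Hb.
  assert (H1 : 0 <= b) by (eapply Rle_trans; [apply Rmax_l|exact Hb]).
  assert (H2 : b0 <= b) by (eapply Rle_trans; [apply Rmax_r|exact Hb]).
  specialize (H b H2).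
  replace (eta * b) with (eta * b / 2 + eta * b / 2) by field. rewrite exp_plus.
  assert (H3 := exp_ineq1_le (eta * b / 2)). assert (0 <= eta * b / 2) by nra. nra.
Qed.

(* The exponents t - N <= n < t are killed, N = B K.  The top al t lies th b to the
   right of x0, which makes the upper Gaussians small; al (t - N) still lies beyond
   the leftmost node, which leaves the lower ones exp (- c b^2) after paying for the
   product of the inverse nodes. *)
Section Estimate.
Context (mu al x0 l th b eps T : R) (K B : nat) (t : Z).
Hypotheses (Hmu : 0 < mu) (Hal : 0 < al) (Hl : 0 < l)
  (Hth : al * INR K - l = 4 * th) (Hth0 : 0 < th) (HK : 1 <= INR K)
  (Hb : b = INR B) (Hb0 : 0 < b) (Heps : 0 < eps)
  (Ht : th * b <= al * IZR t - x0 <= th * b + al)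
  (HT : Rabs (IZR t) <= T)
  (C1 : INR K * b + 1 <= exp (mu * al * th * b))
  (C2 : 1 <= mu * al * th * b)
  (C3 : T - ln eps <= mu * th ^ 2 * b ^ 2)
  (C4 : mu * al * INR K * l * b + T + INR K * b + 1 - ln eps <= 2 * mu * al * INR K * th * b ^ 2).

Let N := (B * K)%nat.

Lemma INR_SN : INR (S N) = INR K * b + 1.
Proof. unfold N; rewrite S_INR, mult_INR, Hb; ring. Qed.

Lemma powSN (j : nat) : INR (S N) ^ j <= exp (INR j * (mu * al * th * b)).
Proof.
  rewrite <- pow_exp, INR_SN. apply pow_incr. split; [nra|exact C1].
Qed.

(** The squared distance from x0 to al (t + j) is at least (th b)^2 + 2 al th b j. The square pays
    for [eps] and [T] by [C3]; of the two copies of mu al th b j, one pays for [INR (S N) ^ j] and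
    the other, by [C2], for the decay in j. *)
Lemma upper_small (j : nat) :
  gauss mu al (t + Z.of_nat j) x0 * INR (S N) ^ j <= eps * exp (- Rabs (IZR (t + Z.of_nat j))).
Proof.
  eapply Rle_trans.
  { apply Rmult_le_compat_l; [left; apply exp_pos|apply powSN]. }
  unfold gauss. rewrite <- (exp_ln eps) by assumption. rewrite <- !exp_plus.
  apply exp_le. rewrite plus_IZR, <- INR_IZR_INZ.
  assert (Hj := pos_INR j). set (jj := INR j) in *.
  assert (Rabs (IZR t + jj) <= T + jj).
  { eapply Rle_trans; [apply Rabs_triang|]. rewrite (Rabs_pos_eq jj); lra. }
  assert (Hq : (x0 - al * (IZR t + jj)) ^ 2 >= th ^ 2 * b ^ 2 + 2 * al * (th * b) * jj).
  { set (tau := al * IZR t - x0) in *.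
    replace (x0 - al * (IZR t + jj)) with (- (tau + al * jj)) by (unfold tau; ring).
    assert (0 < th * b) by nra.
    assert (0 <= al * jj) by nra. nra. }
  assert (mu * (x0 - al * (IZR t + jj)) ^ 2 >= mu * (th ^ 2 * b ^ 2 + 2 * al * (th * b) * jj)) by nra.
  assert (jj * 1 <= jj * (mu * al * th * b)) by (apply Rmult_le_compat_l; lra).
  lra.
Qed.

(** Here exp (- (2 mu al l b)) is the value of w at x0 - l b, hence a lower bound of the nodes, and
    [P] stands for their product. The Gaussian must beat 1 / P, whose exponent is itself quadratic
    in b; the surplus of al K over l decides. *)
Lemma lower_small (j : nat) (P : R) :
  0 < P -> / P <= exp (2 * mu * al * (INR K * l * b * (b + 1) / 2)) ->
  let n := (t - Z.of_nat N - 1 - Z.of_nat j)%Z in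
  gauss mu al n x0 * ((INR (S N) / exp (- (2 * mu * al * l * b))) ^ j / P)
    <= eps * exp (- Rabs (IZR n)).
Proof.
  intros HP0 HP n.
  assert (Hj := pos_INR j).
  assert (E : (INR (S N) / exp (- (2 * mu * al * l * b))) ^ j
     <= exp (INR j * (mu * al * th * b + 2 * mu * al * l * b))).
  { unfold Rdiv. rewrite <- exp_Ropp, Ropp_involutive, Rpow_mult_distr, pow_exp.
    rewrite Rmult_plus_distr_l, exp_plus.
    apply Rmult_le_compat_r; [left; apply exp_pos|apply powSN]. }
  eapply Rle_trans.
  { apply Rmult_le_compat_l; [left; apply exp_pos|].
    apply Rmult_le_compat; [| |exact E|exact HP].
    - apply pow_le. unfold Rdiv. apply Rmult_le_pos; [apply pos_INR|].
      left; apply Rinv_0_lt_compat, exp_pos.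
    - left; now apply Rinv_0_lt_compat. }
  unfold gauss. rewrite <- (exp_ln eps) by assumption. rewrite <- !exp_plus.
  apply exp_le.
  assert (En : IZR n = IZR t - (INR K * b + 1 + INR j)).
  { unfold n. rewrite !minus_IZR, <- !INR_IZR_INZ. unfold N. rewrite mult_INR, <- Hb. ring. }
  rewrite En. set (jj := INR j) in *. set (k := INR K) in *.
  assert (Hkb : 0 <= k * b) by nra.
  assert (Rabs (IZR t - (k * b + 1 + jj)) <= T + (k * b + 1 + jj)).
  { unfold Rminus. eapply Rle_trans; [apply Rabs_triang|].
    rewrite Rabs_Ropp, (Rabs_pos_eq (k * b + 1 + jj)); lra. }
  (* A lower bound for the distance from x0 to al (t - N - 1): the slack [al] in [Ht] is absorbed by
     the shift by 1. *)
  set (s := b * (al * k - th)).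
  assert (Hs : s = b * (l + 3 * th)) by (unfold s; f_equal; lra).
  assert (Hs0 : 0 < s) by (rewrite Hs; apply Rmult_lt_0_compat; lra).
  assert (Hq : s ^ 2 + 2 * s * (al * jj) <= (x0 - al * (IZR t - (k * b + 1 + jj))) ^ 2).
  { set (u := x0 - al * (IZR t - (k * b + 1 + jj))).
    assert (s + al * jj <= u) by (unfold u, s; lra).
    assert (0 <= al * jj) by nra. nra. }
  assert (Hq' : mu * (s ^ 2 + 2 * s * (al * jj)) <= mu * (x0 - al * (IZR t - (k * b + 1 + jj))) ^ 2)
    by (apply Rmult_le_compat_l; lra).
  (* As al k = l + 4 th, the two sides differ by (b th)^2. The part al k l b^2 cancels the quadratic
     cost of 1 / P, and 2 al k th b^2 is left for [C4]. *)
  assert (Hmain : b ^ 2 * (al * k * (l + 2 * th)) <= s ^ 2).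
  { unfold s. assert (al * k = l + 4 * th) by lra.
    replace ((b * (al * k - th)) ^ 2) with (b ^ 2 * (al * k - th) ^ 2) by ring.
    apply Rmult_le_compat_l; [apply pow2_ge_0|]. rewrite H0. nra. }
  assert (Hmain' : mu * (b ^ 2 * (al * k * (l + 2 * th))) <= mu * s ^ 2)
    by (apply Rmult_le_compat_l; lra).
  assert (Hjj : jj * 1 <= jj * (mu * al * th * b)) by (apply Rmult_le_compat_l; lra).
  assert (Hsj : mu * (2 * s * (al * jj)) = 2 * jj * (mu * al * l * b) + 6 * (jj * (mu * al * th * b)))
    by (rewrite Hs; ring).
  nra.
Qed.
End Estimate.

(** The functional is [gauss_divdiff] at the points supplied for a large B. The decay in n allows
    the bound to be summed over a whole series. *)
Lemma gauss_eval_approx (mu al x0 : R) (G : R -> Prop) :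
  0 < mu -> 0 < al -> rich_left al G x0 -> forall eps, 0 < eps ->
  exists Phi : (R -> R) -> R, ptwise_linear Phi /\
    (forall u, (forall x, G x -> u x = 0) -> Phi u = u x0) /\
    (forall n, Rabs (Phi (gauss mu al n)) <= eps * exp (- Rabs (IZR n))).
Proof.
  intros Hmu Hal [K [B0 [l [[Hl Hl'] HG]]]] eps Heps.
  (* A quarter of the surplus of al K over l: the window of killed exponents is moved th b to the
     right of x0 and still reaches about 3 th b beyond the leftmost node. *)
  set (th := (al * INR K - l) / 4).
  assert (Hth0 : 0 < th) by (unfold th; lra).
  assert (Hth : al * INR K - l = 4 * th) by (unfold th; field).
  assert (HK : 1 <= INR K).
  { destruct K; [simpl in Hl'; lra|]. rewrite S_INR. generalize (pos_INR K); lra. }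
  assert (Hm : 0 < mu * al * th) by (repeat apply Rmult_lt_0_compat; lra).
  destruct (exp_dominates_affine (mu * al * th) (INR K) Hm) as [b1 C1].
  (* The terms th / al and |x0| / al + 1 here and below come from the bound [T] on |t|, which grows
     linearly in b. *)
  destruct (quadratic_dominates (mu * th ^ 2) (th / al) (Rabs x0 / al + 1 - ln eps)) as [b3 C3].
  { apply Rmult_lt_0_compat; [lra|apply pow_lt; lra]. }
  destruct (quadratic_dominates (2 * mu * al * INR K * th)
    (mu * al * INR K * l + th / al + INR K) (Rabs x0 / al + 2 - ln eps)) as [b4 C4].
  { repeat apply Rmult_lt_0_compat; lra. }
  destruct (INR_unbounded (Rmax (Rmax 1 (INR B0)) (Rmax (Rmax b1 (/ (mu * al * th))) (Rmax b3 b4))))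
    as [B HB].
  set (b := INR B) in *.
  apply Rmax_Rlt in HB; destruct HB as [HB HB'].
  apply Rmax_Rlt in HB; destruct HB as [Hb1 HB0].
  apply Rmax_Rlt in HB'; destruct HB' as [HB1 HB3].
  apply Rmax_Rlt in HB1; destruct HB1 as [HB1 HB2].
  apply Rmax_Rlt in HB3; destruct HB3 as [HB3 HB4].
  specialize (C1 b (Rlt_le _ _ HB1)).
  specialize (C3 b (Rlt_le _ _ HB3)).
  specialize (C4 b (Rlt_le _ _ HB4)).
  assert (C2 : 1 <= mu * al * th * b).
  { apply (Rmult_lt_compat_l (mu * al * th)) in HB2; [|lra].
    rewrite Rinv_r in HB2 by lra. lra. }
  destruct (HG B) as [xs [Hlen [Hnd [Hxs Hsum]]]].
  { apply INR_le. fold b. lra. }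
  fold b in Hxs, Hsum.
  (* The least integer t for which al t exceeds x0 + th b; exponents from t on are not killed. *)
  set (t := up ((x0 + th * b) / al)).
  assert (Ht : th * b <= al * IZR t - x0 <= th * b + al).
  { destruct (archimed ((x0 + th * b) / al)) as [A1 A2]. fold t in A1, A2.
    assert (E : al * ((x0 + th * b) / al) = x0 + th * b) by (field; lra).
    assert (al * ((x0 + th * b) / al) < al * IZR t) by (apply Rmult_lt_compat_l; lra).
    assert (al * (IZR t - (x0 + th * b) / al) <= al * 1) by (apply Rmult_le_compat_l; lra).
    lra. }
  set (T := Rabs x0 / al + th / al * b + 1).
  assert (HT : Rabs (IZR t) <= T).
  { assert (Hthb : 0 < th * b) by (apply Rmult_lt_0_compat; lra).
    apply (Rmult_le_reg_l al); [lra|].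
    replace (al * T) with (Rabs x0 + th * b + al) by (unfold T; field; lra).
    rewrite <- (Rabs_pos_eq al) at 1 by lra. rewrite <- Rabs_mult.
    replace (al * IZR t) with (x0 + (al * IZR t - x0)) by ring.
    eapply Rle_trans; [apply Rabs_triang|].
    rewrite (Rabs_pos_eq (al * IZR t - x0)); lra. }
  set (k := 2 * mu * al).
  assert (Hk : 0 < k) by (unfold k; repeat apply Rmult_lt_0_compat; lra).
  set (ws := map (fun x => exp (k * (x - x0))) xs).
  set (V := exp (- (k * l * b))).
  assert (HV : 0 < V <= 1).
  { split; [apply exp_pos|]. rewrite <- exp_0. apply exp_le.
    assert (0 < k * l * b) by (repeat apply Rmult_lt_0_compat; lra). lra. }
  assert (Hws : forall w, In w ws -> V <= w < 1).
  { intros w Hw. apply in_map_iff in Hw. destruct Hw as [x [<- Hx]].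
    apply Hxs in Hx. destruct Hx as [_ Hx]. unfold V. rewrite <- exp_0. split.
    - apply exp_le. nra.
    - apply exp_increasing. nra. }
  assert (Hndw : NoDup ws).
  { apply Injective_map_NoDup; [|exact Hnd]. intros x y E.
    apply exp_inv in E. apply Rmult_eq_reg_l in E; lra. }
  assert (Hlw : length ws = (B * K)%nat) by (unfold ws; now rewrite length_map).
  assert (HP : / prodR ws <= exp (k * (INR K * l * b * (b + 1) / 2))).
  (* The nodes are exp (- k (x0 - x)), so the bound on [sum_dist] in [rich_left] is a bound on their
     inverse product. *)
  { assert (E : prodR ws = exp (- (k * sum_dist x0 xs))).
    { unfold ws. clear. induction xs as [|x xs' IH]; simpl.
      - now rewrite Rmult_0_r, Ropp_0, exp_0.
      - rewrite IH, <- exp_plus. f_equal. ring. }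
    rewrite E, <- exp_Ropp, Ropp_involutive. apply exp_le. nra. }
  assert (HP0 : 0 < prodR ws).
  { apply prodR_pos. intros w Hw; apply Hws in Hw; lra. }
  set (p := (t - Z.of_nat (B * K))%Z).
  exists (gauss_divdiff mu al x0 p ws). split; [apply gauss_divdiff_linear|]. split.
  - intros u Hu. apply gauss_divdiff_isolated.
    + intros H; apply Hws in H; lra.
    + intros w Hw. apply in_map_iff in Hw. destruct Hw as [x [<- Hx]].
      apply Hxs in Hx. rewrite ln_exp. fold k.
      replace (x0 + k * (x - x0) / k) with x by (field; lra).
      apply Hu, Hx.
  - intros n.
    destruct (Z_lt_le_dec n p) as [Hn|Hn]; [|destruct (Z_lt_le_dec n t) as [Hn'|Hn']].
    + replace n with (p - 1 - Z.of_nat (Z.to_nat (p - 1 - n)))%Z by lia.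
      set (j := Z.to_nat (p - 1 - n)).
      eapply Rle_trans; [apply (gauss_divdiff_lower mu al x0 V p ws); auto|].
      rewrite Hlw. unfold p, V, k.
      apply (lower_small mu al x0 l th b eps T K B t); auto; try lra.
      unfold T; lra.
    + rewrite (gauss_divdiff_middle mu al x0 V p ws); auto.
      * rewrite Rabs_R0. apply Rmult_le_pos; [lra|left; apply exp_pos].
      * rewrite Hlw; unfold p; lia.
    + replace n with (t + Z.of_nat (Z.to_nat (n - t)))%Z by lia.
      set (j := Z.to_nat (n - t)).
      replace (t + Z.of_nat j)%Z with (p + Z.of_nat (length ws) + Z.of_nat j)%Z
        by (rewrite Hlw; unfold p; lia).
      eapply Rle_trans; [apply (gauss_divdiff_upper mu al x0 V p ws); auto|].
      rewrite Hlw. replace (p + Z.of_nat (B * K))%Z with t by (unfold p; lia).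
      apply (upper_small mu al x0 th b eps T K B t); auto; try lra.
      unfold T; lra.
Qed.

(** * Gaussian series *)

Definition bseq (a : Z -> R) : Prop := exists M, forall k, Rabs (a k) <= M.

Lemma sym_partial_S (a : Z -> R) (N : nat) :
  sym_partial a (S N) = sym_partial a N + (a (Z.of_nat (S N)) + a (- Z.of_nat (S N))%Z).
Proof. unfold sym_partial. rewrite sum_Sn. reflexivity. Qed.

Lemma sym_partial_0 (a : Z -> R) : sym_partial a 0 = a 0%Z.
Proof. unfold sym_partial. now rewrite sum_O. Qed.

Lemma sym_partial_ext (a b : Z -> R) (N : nat) :
  (forall k, a k = b k) -> sym_partial a N = sym_partial b N.
Proof.
  intros H; induction N; [now rewrite !sym_partial_0|].
  now rewrite !sym_partial_S, IHN, !H.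
Qed.

Lemma sym_partial_scal (c : R) (a : Z -> R) (N : nat) :
  sym_partial (fun k => c * a k) N = c * sym_partial a N.
Proof.
  induction N; [now rewrite !sym_partial_0|].
  rewrite !sym_partial_S, IHN; ring.
Qed.

Lemma sym_partial_opp (a : Z -> R) (N : nat) :
  sym_partial (fun k => a (- k)%Z) N = sym_partial a N.
Proof.
  induction N; [now rewrite !sym_partial_0|].
  rewrite !sym_partial_S, IHN, Z.opp_involutive; ring.
Qed.

Lemma sym_partial_Rabs (a b : Z -> R) (N : nat) :
  (forall k, Rabs (a k) <= b k) -> Rabs (sym_partial a N) <= sym_partial b N.
Proof.
  intros H; induction N; [rewrite !sym_partial_0; apply H|].
  rewrite !sym_partial_S.
  eapply Rle_trans; [apply Rabs_triang|]. apply Rplus_le_compat; [exact IHN|].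
  eapply Rle_trans; [apply Rabs_triang|]. now apply Rplus_le_compat.
Qed.

Lemma sym_partial_exp (N : nat) : sym_partial (fun k => exp (- Rabs (IZR k))) N <= 5.
Proof.
  (* The remainder 4 exp (- N) makes the induction close: since exp 1 >= 2, its decrease covers the
     two new terms. *)
  assert (H : sym_partial (fun k => exp (- Rabs (IZR k))) N <= 5 - 4 * exp (- INR N)).
  { induction N as [|N IHN].
    - rewrite sym_partial_0. simpl. rewrite Rabs_R0, Ropp_0, exp_0. lra.
    - rewrite sym_partial_S, opp_IZR, Rabs_Ropp, <- INR_IZR_INZ, Rabs_pos_eq by apply pos_INR.
      assert (E : exp (- INR N) = exp 1 * exp (- INR (S N))).
      { rewrite <- exp_plus. f_equal. rewrite S_INR. ring. }
      assert (H1 := exp_ineq1_le 1). assert (H2 := exp_pos (- INR (S N))). nra. }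
  assert (H2 := exp_pos (- INR N)). lra.
Qed.

Lemma ptwise_linear_sym_partial (Phi : (R -> R) -> R) (F : Z -> R -> R) (N : nat) :
  ptwise_linear Phi ->
  Phi (fun x => sym_partial (fun k => F k x) N) = sym_partial (fun k => Phi (F k)) N.
Proof.
  intros [Hext [Hplus _]]. induction N as [|N IHN].
  - rewrite sym_partial_0. apply Hext. intros x. now rewrite sym_partial_0.
  - rewrite sym_partial_S, <- IHN, <- !Hplus. apply Hext. intros x.
    now rewrite sym_partial_S.
Qed.

Definition gauss_sum (lam beta : R) (a : Z -> R) (x : R) : R :=
  real (Lim_seq (sym_partial (fun k => a k * gauss lam beta k x))).

(** Half of the Laurent series: only indices n >= 0, so that power series apply. The other half is
    the same construction for the reflected sequence, in 1/w. *)
Definition theta_coeff (q : R) (a : Z -> R) (n : nat) : R :=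
  a (Z.of_nat n) * exp (- q * INR n ^ 2).

(** As |r|^n <= exp (|r| n), completing the square in - q n^2 + |r| n bounds the terms by M exp (r^2
    / (4 q)) for every r. *)
Lemma theta_CV_radius (q : R) (a : Z -> R) : 0 < q -> bseq a ->
  CV_radius (theta_coeff q a) = p_infty.
Proof.
  intros Hq [M HM].
  assert (H : forall r, Rbar_le (Finite r) (CV_radius (theta_coeff q a))).
  { intros r. eapply Rbar_le_trans; [apply (Rle_abs r : Rbar_le (Finite _) (Finite _))|].
    apply CV_radius_bounded. exists (M * exp (Rabs r ^ 2 / (4 * q))).
    set (s := Rabs r). intros n. unfold theta_coeff.
    rewrite Rmult_assoc, Rabs_mult. apply Rmult_le_compat; [apply Rabs_pos|apply Rabs_pos|apply HM|].
    assert (Hs : 0 <= s) by apply Rabs_pos.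
    rewrite Rabs_pos_eq by (apply Rmult_le_pos; [left; apply exp_pos|now apply pow_le]).
    eapply Rle_trans.
    - apply Rmult_le_compat_l; [left; apply exp_pos|].
      apply (pow_incr s (exp s)). split; [exact Hs|]. generalize (exp_ineq1_le s); lra.
    - rewrite pow_exp, <- exp_plus. apply exp_le.
      apply (Rmult_le_reg_l (4 * q)); [lra|].
      replace (4 * q * (s ^ 2 / (4 * q))) with (s ^ 2) by (field; lra).
      set (m := INR n). assert (H := pow2_ge_0 (s - 2 * q * m)). lra. }
  destruct (CV_radius (theta_coeff q a)) as [r| |]; auto.
  - specialize (H (r + 1)). simpl in H. lra.
  - now specialize (H 0).
Qed.

Section Theta.
Context (lam beta : R) (Hlam : 0 < lam) (Hbeta : 0 < beta).

Definition theta (a : Z -> R) : R -> R := PSeries (theta_coeff (lam * beta ^ 2) a).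

Let Hq : 0 < lam * beta ^ 2.
Proof. apply Rmult_lt_0_compat; [|apply pow_lt]; assumption. Qed.

Lemma bseq_opp (a : Z -> R) : bseq a -> bseq (fun k => a (- k)%Z).
Proof. intros [M HM]; exists M; intros k; apply HM. Qed.

Lemma is_lim_seq_theta (a : Z -> R) (w : R) : bseq a ->
  is_lim_seq (sum_n (fun n => theta_coeff (lam * beta ^ 2) a n * w ^ n)) (theta a w).
Proof.
  intros Ha. apply (is_pseries_R (theta_coeff (lam * beta ^ 2) a)).
  apply PSeries_correct, CV_radius_inside. now rewrite theta_CV_radius.
Qed.

(** Both halves of the Laurent series contain the term of index 0, hence the [- a 0%Z]. *)
Lemma is_lim_seq_gauss_theta (a : Z -> R) (x : R) : bseq a ->
  is_lim_seq (sym_partial (fun k => a k * gauss lam beta k x))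
    (exp (- lam * x ^ 2) * (theta a (exp (2 * lam * beta * x))
       + theta (fun k => a (- k)%Z) (exp (- (2 * lam * beta * x))) - a 0%Z)).
Proof.
  intros Ha.
  apply (is_lim_seq_ext (fun N => exp (- lam * x ^ 2) *
    (sum_n (fun n => theta_coeff (lam * beta ^ 2) a n * exp (2 * lam * beta * x) ^ n) N
     + sum_n (fun n => theta_coeff (lam * beta ^ 2) (fun k => a (- k)%Z) n
          * exp (- (2 * lam * beta * x)) ^ n) N - a 0%Z))).
  - assert (E : forall n,
      exp (- lam * x ^ 2) * (theta_coeff (lam * beta ^ 2) a n * exp (2 * lam * beta * x) ^ n)
       = a (Z.of_nat n) * gauss lam beta (Z.of_nat n) x /\
      exp (- lam * x ^ 2) * (theta_coeff (lam * beta ^ 2) (fun k => a (- k)%Z) n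
         * exp (- (2 * lam * beta * x)) ^ n)
       = a (- Z.of_nat n)%Z * gauss lam beta (- Z.of_nat n) x).
    { intros n. unfold theta_coeff, gauss. rewrite !pow_exp, opp_IZR, <- INR_IZR_INZ.
      set (m := INR n). split.
      - replace (- lam * (x - beta * m) ^ 2)
          with (- lam * x ^ 2 + (- (lam * beta ^ 2) * m ^ 2 + m * (2 * lam * beta * x))) by ring.
        rewrite !exp_plus; ring.
      - replace (- lam * (x - beta * - m) ^ 2)
          with (- lam * x ^ 2 + (- (lam * beta ^ 2) * m ^ 2 + m * - (2 * lam * beta * x))) by ring.
        rewrite !exp_plus; ring. }
    intros N; induction N as [|N IHN].
    + rewrite !sum_O, sym_partial_0.
      destruct (E 0%nat) as [E1 E2]. simpl Z.of_nat in *.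
      change (- 0)%Z with 0%Z in E2.
      rewrite Rmult_minus_distr_l, Rmult_plus_distr_l, E1, E2.
      unfold gauss. rewrite Rmult_0_r, Rminus_0_r. ring.
    + rewrite !sum_Sn, sym_partial_S, <- IHN.
      destruct (E (S N)) as [E1 E2]. rewrite <- E1, <- E2. unfold plus; simpl. ring.
  - apply (is_lim_seq_scal_l _ _ (Finite _)).
    apply is_lim_seq_minus'; [|apply is_lim_seq_const].
    apply is_lim_seq_plus'; apply is_lim_seq_theta; auto. now apply bseq_opp.
Qed.

Lemma is_lim_seq_gauss_sum (a : Z -> R) (x : R) : bseq a ->
  is_lim_seq (sym_partial (fun k => a k * gauss lam beta k x)) (gauss_sum lam beta a x).
Proof.
  intros Ha. unfold gauss_sum. assert (H := is_lim_seq_gauss_theta a x Ha).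
  rewrite (is_lim_seq_unique _ _ H). exact H.
Qed.

Lemma gauss_sum_theta (a : Z -> R) (x : R) : bseq a ->
  gauss_sum lam beta a x =
    exp (- lam * x ^ 2) * (theta a (exp (2 * lam * beta * x))
       + theta (fun k => a (- k)%Z) (exp (- (2 * lam * beta * x))) - a 0%Z).
Proof.
  intros Ha. unfold gauss_sum.
  now rewrite (is_lim_seq_unique _ _ (is_lim_seq_gauss_theta a x Ha)).
Qed.

Lemma is_derive_theta (a : Z -> R) (w : R) : bseq a ->
  is_derive (theta a) w (PSeries (PS_derive (theta_coeff (lam * beta ^ 2) a)) w).
Proof.
  intros Ha. apply is_derive_PSeries. now rewrite theta_CV_radius.
Qed.

Lemma theta_index_mul (a : Z -> R) (w : R) :
  w * PSeries (PS_derive (theta_coeff (lam * beta ^ 2) a)) w = theta (fun k => IZR k * a k) w.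
Proof.
  rewrite <- PSeries_incr_1. apply PSeries_ext. intros [|n]; unfold PS_incr_1, PS_derive, theta_coeff.
  - unfold zero; simpl. ring.
  - rewrite (INR_IZR_INZ (S n)). ring.
Qed.

(** On the theta form, w d/dw multiplies each coefficient by its index, and the prefactor
    contributes - 2 lam x times the series. *)
Lemma is_derive_gauss_sum (a : Z -> R) (x : R) :
  bseq a -> bseq (fun k => IZR k * a k) ->
  is_derive (gauss_sum lam beta a) x
    (2 * lam * (beta * gauss_sum lam beta (fun k => IZR k * a k) x
       - x * gauss_sum lam beta a x)).
Proof.
  intros Ha Hka.
  apply (is_derive_ext (fun x => exp (- lam * x ^ 2) * (theta a (exp (2 * lam * beta * x))
       + theta (fun k => a (- k)%Z) (exp (- (2 * lam * beta * x))) - a 0%Z))).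
  { intros t. now rewrite gauss_sum_theta. }
  rewrite !gauss_sum_theta by assumption.
  assert (H1 := is_derive_theta a (exp (2 * lam * beta * x)) Ha).
  assert (H2 := is_derive_theta _ (exp (- (2 * lam * beta * x))) (bseq_opp a Ha)).
  auto_derive.
  - split; [|split; [|exact I]].
    + eexists; exact H1.
    + eexists; exact H2.
  - replace (Derive (fun x => theta a x) (exp (2 * lam * beta * x))) with
      (PSeries (PS_derive (theta_coeff (lam * beta ^ 2) a)) (exp (2 * lam * beta * x)))
      by (symmetry; now apply is_derive_unique).
    replace (Derive (fun x => theta (fun k => a (- k)%Z) x) (exp (- (2 * lam * beta * x)))) with
      (PSeries (PS_derive (theta_coeff (lam * beta ^ 2) (fun k => a (- k)%Z)))
        (exp (- (2 * lam * beta * x))))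
      by (symmetry; now apply is_derive_unique).
    assert (E1 := theta_index_mul a (exp (2 * lam * beta * x))).
    assert (E2 := theta_index_mul (fun k => a (- k)%Z) (exp (- (2 * lam * beta * x)))).
    (* In the reflected half the index is - k; this sign matches the inner derivative of exp (- (2
       lam beta x)). *)
    assert (E3 : theta (fun k => IZR (- k) * a (- k)%Z) (exp (- (2 * lam * beta * x)))
      = - theta (fun k => IZR k * a (- k)%Z) (exp (- (2 * lam * beta * x)))).
    { unfold theta. rewrite <- PSeries_opp. apply PSeries_ext. intros n.
      unfold PS_opp, theta_coeff, opp; simpl. rewrite opp_IZR. ring. }
    rewrite E3, <- E1, <- E2. replace (x * (x * 1)) with (x ^ 2) by ring. ring.
Qed.
End Theta.

(** * Uniqueness for products of Gaussian series *)

(** The linear span of products of two series, given inductively so that bounds, reflection and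
    differentiability follow by induction on the generation of a function. *)
Inductive quad (lam beta : R) : (R -> R) -> Prop :=
| quad_prod a b : bseq a -> bseq b ->
    quad lam beta (fun x => gauss_sum lam beta a x * gauss_sum lam beta b x)
| quad_plus u v : quad lam beta u -> quad lam beta v -> quad lam beta (fun x => u x + v x)
| quad_scal c u : quad lam beta u -> quad lam beta (fun x => c * u x)
| quad_ext u v : quad lam beta u -> (forall x, u x = v x) -> quad lam beta v.

(** Parallelogram identity: (x - beta k)^2 + (x - beta j)^2 = 2 (x - beta (k + j) / 2)^2 + beta^2 (k
    - j)^2 / 2. *)
Lemma gauss_mul (lam beta x : R) (k j : Z) :
  gauss lam beta k x * gauss lam beta j x =
  exp (- (lam * beta ^ 2 / 2) * IZR (k - j) ^ 2) * gauss (2 * lam) (beta / 2) (k + j) x.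
Proof.
  unfold gauss. rewrite <- !exp_plus. f_equal. rewrite plus_IZR, minus_IZR. field.
Qed.

Lemma gauss_decay (q m : R) : 0 < q ->
  exp (- q * m ^ 2) <= exp (/ (4 * q)) * exp (- Rabs m).
Proof.
  intros Hq. rewrite <- exp_plus. apply exp_le. rewrite <- (pow2_abs m). set (s := Rabs m).
  apply (Rmult_le_reg_l (4 * q)); [lra|].
  rewrite Rmult_plus_distr_l, Rinv_r by lra.
  assert (H := pow2_ge_0 (2 * q * s - 1)). lra.
Qed.

Lemma Rabs_sum_le_sum_diff (a b : R) : Rabs a + Rabs b <= Rabs (a + b) + Rabs (a - b).
Proof. unfold Rabs; repeat destruct Rcase_abs; lra. Qed.

(** The product of terms k and j is a Gaussian of index k + j with a weight decaying in k - j. As |k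
    + j| + |k - j| >= |k| + |j|, the double sum converges. It matters that C depends on u alone, so
    that [eps] can tend to 0 afterwards. *)
Lemma quad_bound (lam beta : R) (u : R -> R) : 0 < lam -> 0 < beta -> quad lam beta u ->
  exists C, 0 <= C /\ forall Phi eps, ptwise_linear Phi -> 0 < eps ->
    (forall n, Rabs (Phi (gauss (2 * lam) (beta / 2) n)) <= eps * exp (- Rabs (IZR n))) ->
    Rabs (Phi u) <= C * eps.
Proof.
  intros Hlam Hbeta Hu.
  induction Hu as [a b [A HA] [B HB]|u v _ [C1 [HC1 IH1]] _ [C2 [HC2 IH2]]|c u _ [C1 [HC1 IH1]]
    |u v _ [C1 [HC1 IH1]] Huv].
  - assert (Ha : bseq a) by now exists A. assert (Hb : bseq b) by now exists B.
    assert (HA0 : 0 <= A) by (eapply Rle_trans; [apply Rabs_pos|apply (HA 0%Z)]).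
    assert (HB0 : 0 <= B) by (eapply Rle_trans; [apply Rabs_pos|apply (HB 0%Z)]).
    set (q := lam * beta ^ 2 / 2).
    assert (Hq : 0 < q) by (unfold q; assert (0 < beta ^ 2) by (apply pow_lt; lra); nra).
    assert (HE : 0 < exp (/ (4 * q))) by apply exp_pos.
    set (E := exp (/ (4 * q))) in *.
    (* 25 = 5 * 5, one factor from [sym_partial_exp] for each of the two summations. *)
    exists (25 * (A * B * E)). split; [repeat apply Rmult_le_pos; lra|].
    intros Phi eps HPhi Heps Hsmall.
    assert (Hkj : forall k j, Rabs (Phi (fun x => (a k * gauss lam beta k x) * (b j * gauss lam beta j x)))
      <= (A * B * E * eps * exp (- Rabs (IZR k))) * exp (- Rabs (IZR j))).
    { intros k j. destruct HPhi as [Hext [_ [Hscal _]]].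
      rewrite (Hext _ (fun x => (a k * b j * exp (- q * IZR (k - j) ^ 2))
        * gauss (2 * lam) (beta / 2) (k + j) x)).
      2:{ intros x. transitivity (a k * b j * (gauss lam beta k x * gauss lam beta j x)); [ring|].
          rewrite gauss_mul. fold q. ring. }
      rewrite Hscal, !Rabs_mult, (Rabs_pos_eq (exp _)) by (left; apply exp_pos).
      apply Rle_trans with ((A * B * (E * exp (- Rabs (IZR (k - j)))))
         * (eps * exp (- Rabs (IZR (k + j))))).
      - apply Rmult_le_compat; auto; try apply Rabs_pos.
        + repeat apply Rmult_le_pos; try apply Rabs_pos. left; apply exp_pos.
        + apply Rmult_le_compat; [| left; apply exp_pos | |now apply gauss_decay].
          * apply Rmult_le_pos; apply Rabs_pos.
          * apply Rmult_le_compat; auto; apply Rabs_pos.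
      - replace (A * B * (E * exp (- Rabs (IZR (k - j)))) * (eps * exp (- Rabs (IZR (k + j)))))
          with (A * B * E * eps * (exp (- Rabs (IZR (k - j))) * exp (- Rabs (IZR (k + j))))) by ring.
        rewrite (Rmult_assoc _ (exp _) (exp _)), <- !exp_plus.
        apply Rmult_le_compat_l; [repeat apply Rmult_le_pos; lra|].
        apply exp_le. rewrite plus_IZR, minus_IZR.
        generalize (Rabs_sum_le_sum_diff (IZR k) (IZR j)); lra. }
    assert (HK : forall K, Rabs (Phi (fun x => sym_partial (fun k => a k * gauss lam beta k x) K
        * sym_partial (fun k => b k * gauss lam beta k x) K)) <= 25 * (A * B * E) * eps).
    { intros K. assert (HPhi' := HPhi). destruct HPhi' as [Hext _].
      rewrite (Hext _ (fun x => sym_partial (fun k => sym_partial (fun j =>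
         (a k * gauss lam beta k x) * (b j * gauss lam beta j x)) K) K)).
      2:{ intros x. rewrite Rmult_comm, <- sym_partial_scal. apply sym_partial_ext. intros k.
          rewrite sym_partial_scal. ring. }
      rewrite (ptwise_linear_sym_partial Phi (fun k x => sym_partial (fun j =>
         (a k * gauss lam beta k x) * (b j * gauss lam beta j x)) K)) by exact HPhi.
      eapply Rle_trans.
      { apply (sym_partial_Rabs _ (fun k => (5 * (A * B * E * eps)) * exp (- Rabs (IZR k)))). intros k.
        rewrite (ptwise_linear_sym_partial Phi (fun j x =>
          (a k * gauss lam beta k x) * (b j * gauss lam beta j x))) by exact HPhi.
        eapply Rle_trans; [apply sym_partial_Rabs; intros j; apply Hkj|].
        rewrite sym_partial_scal.
        assert (H5 := sym_partial_exp K).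
        assert (0 <= A * B * E * eps * exp (- Rabs (IZR k)))
          by (repeat apply Rmult_le_pos; try lra; left; apply exp_pos).
        nra. }
      rewrite sym_partial_scal.
      assert (H5 := sym_partial_exp K).
      assert (0 <= A * B * E * eps) by (repeat apply Rmult_le_pos; lra).
      nra. }
    assert (HL : is_lim_seq (fun K => Phi (fun x => sym_partial (fun k => a k * gauss lam beta k x) K
        * sym_partial (fun k => b k * gauss lam beta k x) K))
        (Phi (fun x => gauss_sum lam beta a x * gauss_sum lam beta b x))).
    { destruct HPhi as [_ [_ [_ Hlim]]].
      apply (Hlim (fun K x => sym_partial (fun k => a k * gauss lam beta k x) K
        * sym_partial (fun k => b k * gauss lam beta k x) K)).
      intros x. apply is_lim_seq_mult'; now apply is_lim_seq_gauss_sum. }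
    apply is_lim_seq_abs in HL.
    exact (is_lim_seq_le _ _ _ _ HK HL (is_lim_seq_const _)).
  - exists (C1 + C2). split; [lra|]. intros Phi eps HPhi Heps Hs.
    specialize (IH1 Phi eps HPhi Heps Hs). specialize (IH2 Phi eps HPhi Heps Hs).
    destruct HPhi as [_ [Hplus _]]. rewrite Hplus.
    eapply Rle_trans; [apply Rabs_triang|]. lra.
  - exists (Rabs c * C1). split; [apply Rmult_le_pos; [apply Rabs_pos|lra]|].
    intros Phi eps HPhi Heps Hs.
    specialize (IH1 Phi eps HPhi Heps Hs).
    destruct HPhi as [_ [_ [Hscal _]]]. rewrite Hscal, Rabs_mult, Rmult_assoc.
    apply Rmult_le_compat_l; [apply Rabs_pos|exact IH1].
  - exists C1. split; [exact HC1|]. intros Phi eps HPhi Heps Hs.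
    specialize (IH1 Phi eps HPhi Heps Hs).
    destruct HPhi as [Hext _]. now rewrite <- (Hext u v Huv).
Qed.

(** The approximate evaluation is exact on u, which vanishes on [G], and its value is at most C eps
    for every eps. *)
Lemma quad_zero_rich (lam beta x0 : R) (G : R -> Prop) (u : R -> R) :
  0 < lam -> 0 < beta -> quad lam beta u -> rich_left (beta / 2) G x0 ->
  (forall x, G x -> u x = 0) -> u x0 = 0.
Proof.
  intros Hlam Hbeta Hu HG H0.
  destruct (quad_bound lam beta u Hlam Hbeta Hu) as [C [HC HPhi]].
  assert (H : forall eps, 0 < eps -> Rabs (u x0) <= C * eps).
  { intros eps Heps.
    destruct (gauss_eval_approx (2 * lam) (beta / 2) x0 G ltac:(lra) ltac:(lra) HG eps Heps)
      as [Phi [H1 [H2 H3]]].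
    rewrite <- (H2 u H0). now apply HPhi. }
  destruct (Req_dec (u x0) 0) as [E|E]; [exact E|exfalso].
  apply Rabs_pos_lt in E.
  specialize (H (Rabs (u x0) / (2 * (C + 1)))).
  assert (0 < Rabs (u x0) / (2 * (C + 1))) by (apply Rdiv_lt_0_compat; lra).
  specialize (H H1).
  assert (Rabs (u x0) = 2 * (C + 1) * (Rabs (u x0) / (2 * (C + 1)))) by (field; lra).
  nra.
Qed.

(** Needed because [rich_left] speaks only of points on one side; reflection replaces the index k by
    - k. *)
Lemma quad_reflect (lam beta : R) (u : R -> R) : quad lam beta u ->
  quad lam beta (fun x => u (- x)).
Proof.
  assert (E : forall a x, gauss_sum lam beta (fun k => a (- k)%Z) x = gauss_sum lam beta a (- x)).
  { intros a x. unfold gauss_sum. f_equal. apply Lim_seq_ext. intros N.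
    rewrite <- sym_partial_opp. apply sym_partial_ext. intros k. unfold gauss.
    rewrite Z.opp_involutive, opp_IZR. do 3 f_equal. ring. }
  induction 1 as [a b Ha Hb|u v _ IH1 _ IH2|c u _ IH|u v _ IH Huv].
  - apply (quad_ext _ _ _ _ (quad_prod lam beta _ _ (bseq_opp a Ha) (bseq_opp b Hb))).
    intros x. now rewrite !E.
  - now apply (quad_plus _ _ (fun x => u (- x)) (fun x => v (- x))).
  - now apply (quad_scal _ _ c (fun x => u (- x))).
  - apply (quad_ext _ _ _ _ IH). intros x; apply Huv.
Qed.

(** * Intervals and sets of large lower density as uniqueness sets *)

Lemma interval_points (l r : R) (n : nat) : l < r ->
  exists xs, length xs = n /\ NoDup xs /\ forall x, In x xs -> l < x < r.
Proof.
  intros Hlr.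
  set (f := fun i => l + (r - l) * ((INR i + 1) / (INR n + 1))).
  assert (Hn := pos_INR n).
  exists (map f (seq 0 n)). split; [|split].
  - now rewrite length_map, length_seq.
  - apply Injective_map_NoDup; [|apply seq_NoDup]. intros i j E. unfold f in E.
    apply Rplus_eq_reg_l in E. apply Rmult_eq_reg_l in E; [|lra].
    unfold Rdiv in E. apply Rmult_eq_reg_r in E.
    + apply INR_eq. lra.
    + apply Rgt_not_eq, Rinv_0_lt_compat. lra.
  - intros x Hx. apply in_map_iff in Hx. destruct Hx as [i [<- Hi]].
    apply in_seq in Hi. destruct Hi as [_ Hi]. apply lt_INR in Hi. simpl in Hi.
    assert (Hi0 := pos_INR i). unfold f.
    assert (0 < (INR i + 1) / (INR n + 1)) by (apply Rdiv_lt_0_compat; lra).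
    assert ((INR i + 1) / (INR n + 1) < 1) by (apply Rlt_div_l; lra).
    split; nra.
Qed.

Lemma sum_dist_bound (x0 D : R) (xs : list R) :
  (forall x, In x xs -> x0 - x <= D) -> sum_dist x0 xs <= INR (length xs) * D.
Proof.
  induction xs as [|x xs IH]; intros H.
  - simpl. lra.
  - change (length (x :: xs)) with (S (length xs)). rewrite S_INR.
    assert (x0 - x <= D) by (apply H; now left).
    assert (sum_dist x0 xs <= INR (length xs) * D) by (apply IH; intros; apply H; now right).
    simpl. lra.
Qed.

Lemma sum_dist_app (x0 : R) (xs ys : list R) :
  sum_dist x0 (xs ++ ys) = sum_dist x0 xs + sum_dist x0 ys.
Proof. induction xs as [|x xs IH]; simpl; [ring|]. rewrite IH; ring. Qed.

(** An interval supplies any number of points, so one per block of length al / 2 will do. Their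
    distances to x0 stay below x0 - l, so the sum of distances is only linear in B. *)
Lemma rich_left_interval (al l r x0 : R) : 0 < al -> l < r -> l < x0 ->
  rich_left al (fun x => l < x < r) x0.
Proof.
  intros Hal Hlr Hx0.
  destruct (INR_unbounded ((x0 - l) / (al / 4))) as [B0 HB0].
  exists 1%nat, B0, (al / 2). split; [simpl; lra|]. intros B HB.
  apply le_INR in HB.
  assert (H : x0 - l <= al / 4 * INR B).
  { replace (x0 - l) with (al / 4 * ((x0 - l) / (al / 4))) by (field; lra).
    apply Rmult_le_compat_l; lra. }
  assert (HB' := pos_INR B).
  assert (H' : 0 <= al / 4 * INR B) by (apply Rmult_le_pos; lra).
  destruct (interval_points l (Rmin r x0) B) as [xs [Hlen [Hnd Hxs]]].
  { apply Rmin_case; lra. }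
  exists xs. split; [lia|]. split; [exact Hnd|]. split.
  - intros x Hx. apply Hxs in Hx.
    assert (H1 := Rmin_l r x0). assert (H2 := Rmin_r r x0). lra.
  - eapply Rle_trans; [apply (sum_dist_bound _ (x0 - l))|].
    + intros x Hx. apply Hxs in Hx. lra.
    + rewrite Hlen. simpl INR.
      assert (INR B * (x0 - l) <= INR B * (al / 4 * (INR B + 1))) by (apply Rmult_le_compat_l; lra).
      lra.
Qed.

(** A point to the right of l has part of the interval on its left; any other point is handled after
    reflection. *)
Lemma quad_zero_interval (lam beta l r : R) (u : R -> R) :
  0 < lam -> 0 < beta -> quad lam beta u -> l < r ->
  (forall x, l < x < r -> u x = 0) -> forall x, u x = 0.
Proof.
  intros Hlam Hbeta Hu Hlr H0 x.
  destruct (Rlt_le_dec l x) as [Hx|Hx].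
  - apply (quad_zero_rich lam beta x (fun x => l < x < r) u); auto.
    apply rich_left_interval; lra.
  - rewrite <- (Ropp_involutive x).
    apply (quad_zero_rich lam beta (- x) (fun x => - r < x < - l) (fun x => u (- x))); auto.
    + now apply quad_reflect.
    + apply rich_left_interval; lra.
    + intros y Hy. apply H0. lra.
Qed.

Lemma rich_left_blocks (al h : R) (K : nat) (G : R -> Prop) (x0 : R) :
  0 < al -> 0 < h -> 2 * h < al * INR K ->
  (forall x, exists l, length l = K /\ NoDup l /\ forall y, In y l -> G y /\ x - h <= y <= x + h) ->
  rich_left al G x0.
Proof.
  intros Hal Hh HK HG.
  (* The midpoint of 2 h and al K: blocks longer than 2 h keep the windows disjoint, and l < al K is
     what [rich_left] asks. *)
  set (l := (2 * h + al * INR K) / 2).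
  exists K, 0%nat, l. split; [unfold l; lra|]. intros B _.
  induction B as [|B [xs [Hlen [Hnd [Hxs Hsum]]]]].
  - exists nil. repeat split; try (simpl in *; tauto). constructor. simpl. lra.
  (* The centre of block number B, whose window lies inside the block as h < l / 2. Each of its K
     points costs at most l (B + 1), and these costs add up to the quadratic bound. *)
  - destruct (HG (x0 - l * (INR B + / 2))) as [ys [Hylen [Hynd Hys]]].
    assert (Hy : forall y, In y ys -> G y /\ x0 - l * (INR B + 1) <= y < x0 - l * INR B).
    { intros y H. apply Hys in H. split; [apply H|]. destruct H as [_ H].
      assert (2 * h < l) by (unfold l; lra). lra. }
    exists (ys ++ xs). rewrite length_app, S_INR, sum_dist_app.
    assert (HB := pos_INR B). assert (Hl : 0 < l) by (unfold l; lra).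
    assert (0 <= l * INR B) by nra.
    split; [simpl; lia|]. split; [|split].
    + apply NoDup_app; auto. intros y H1 H2. apply Hy in H1. apply Hxs in H2. lra.
    + intros y H1. apply in_app_iff in H1. destruct H1 as [H1|H1].
      * apply Hy in H1. split; [apply H1|]. lra.
      * apply Hxs in H1. split; [apply H1|]. lra.
    + assert (sum_dist x0 ys <= INR (length ys) * (l * (INR B + 1))).
      { apply sum_dist_bound. intros y H1. apply Hy in H1. lra. }
      rewrite Hylen in *. lra.
Qed.

Lemma count_in_exceeds (Gamma : R -> Prop) (x r s : R) :
  ~ Rbar_le (count_in Gamma x r) (Finite s) ->
  exists l, s < INR (length l) /\ NoDup l /\ forall y, In y l -> Gamma y /\ x - r <= y <= x + r.
Proof.
  intros Hc. apply NNPP. intros Hno. apply Hc. clear Hc.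
  unfold count_in, Rbar_lub. destruct Rbar_ex_lub as [L [HU HL]]; simpl.
  apply HL. intros t [l [Hnd [Hall ->]]]. simpl.
  apply Rnot_lt_le. intros Hlt. apply Hno. exists l. split; [exact Hlt|]. split; [exact Hnd|].
  now apply Forall_forall.
Qed.

(** If at every scale h some window held at most 2 h delta points, every infimum in the density
    would be at most delta, hence also their supremum. *)
Lemma density_blocks (Gamma : R -> Prop) (delta : R) :
  Rbar_lt (Finite delta) (lower_beurling_density Gamma) ->
  exists h, 0 < h /\ forall x, exists l, 2 * h * delta < INR (length l) /\ NoDup l /\ forall y, In y l -> Gamma y /\ x - h <= y <= x + h.
Proof.
  intros HD. apply NNPP. intros Hno.
  apply (Rbar_lt_not_le _ _ HD).
  clear HD. unfold lower_beurling_density, Rbar_lub. destruct Rbar_ex_lub as [L [HU HL]]; simpl.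
  apply HL. intros t [h [Hh ->]].
  unfold Rbar_glb at 1. destruct Rbar_ex_glb as [g [Hg HgU]]; simpl.
  eapply Rbar_le_trans; [apply Hg; exists h; split; [apply Rle_refl|reflexivity]|].
  unfold inf_count_ratio, Rbar_glb. destruct Rbar_ex_glb as [g' [Hg' HgU']]; simpl.
  apply NNPP. intros Hgd. apply Hno. exists h. split; [exact Hh|]. intros x.
  apply count_in_exceeds. intros Hc. apply Hgd.
  eapply Rbar_le_trans; [apply Hg'; exists x; reflexivity|].
  assert (Hi : 0 < / (2 * h)) by (apply Rinv_0_lt_compat; lra).
  destruct (count_in Gamma x h) as [c| |]; simpl in Hc; [|contradiction|].
  - simpl. apply (Rmult_le_compat_r (/ (2 * h))) in Hc; [|lra].
    replace (2 * h * delta * / (2 * h)) with delta in Hc by (field; lra). exact Hc.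
  (* The formal case of a count equal to minus infinity, which a positive factor preserves. *)
  - rewrite Rbar_mult_comm. unfold Rbar_mult, Rbar_mult'.
    destruct Rle_dec; [|lra]. destruct Rle_lt_or_eq_dec; [exact I|lra].
Qed.

(** K is the least integer above 2 h / al. A window with more than 2 h / al points has at least K of
    them, and exactly K are kept. *)
Lemma rich_left_density (al : R) (Gamma : R -> Prop) (x0 : R) : 0 < al ->
  Rbar_lt (Finite (/ al)) (lower_beurling_density Gamma) -> rich_left al Gamma x0.
Proof.
  intros Hal HD.
  destruct (density_blocks Gamma (/ al) HD) as [h [Hh Hb]].
  assert (Hs : 0 <= 2 * h * / al) by (apply Rmult_le_pos; [lra|left; now apply Rinv_0_lt_compat]).
  destruct (archimed (2 * h * / al)) as [A1 A2].
  set (K := Z.to_nat (up (2 * h * / al))).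
  assert (HK : INR K = IZR (up (2 * h * / al))).
  { unfold K. rewrite INR_IZR_INZ, Z2Nat.id; [reflexivity|]. apply le_IZR. lra. }
  apply (rich_left_blocks al h K); auto.
  - rewrite HK. apply (Rmult_lt_compat_l al) in A1; [|lra].
    replace (al * (2 * h * / al)) with (2 * h) in A1 by (field; lra). exact A1.
  - intros x. destruct (Hb x) as [l [Hl [Hnd Hin]]].
    exists (firstn K l). split; [|split].
    + apply firstn_length_le. unfold K.
      assert (up (2 * h * / al) < Z.of_nat (length l) + 1)%Z.
      { apply lt_IZR. rewrite plus_IZR, <- INR_IZR_INZ. lra. }
      lia.
    + rewrite <- (firstn_skipn K l) in Hnd. now apply NoDup_app_remove_r in Hnd.
    + intros y Hy. apply Hin. rewrite <- (firstn_skipn K l). apply in_or_app. now left.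
Qed.

(** * Phase retrieval *)

Lemma bseq_lin (s : R) (a b : Z -> R) : bseq a -> bseq b -> bseq (fun k => a k + s * b k).
Proof.
  intros [A HA] [B HB]. exists (A + Rabs s * B). intros k.
  eapply Rle_trans; [apply Rabs_triang|]. rewrite Rabs_mult.
  apply Rplus_le_compat; [apply HA|]. apply Rmult_le_compat_l; [apply Rabs_pos|apply HB].
Qed.

Lemma gauss_sum_lin (lam beta s x : R) (a b : Z -> R) : 0 < lam -> 0 < beta -> bseq a -> bseq b ->
  gauss_sum lam beta (fun k => a k + s * b k) x = gauss_sum lam beta a x + s * gauss_sum lam beta b x.
Proof.
  intros Hlam Hbeta Ha Hb. unfold gauss_sum at 1.
  rewrite (is_lim_seq_unique _ (gauss_sum lam beta a x + s * gauss_sum lam beta b x)); [reflexivity|].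
  apply (is_lim_seq_ext (fun N => sym_partial (fun k => a k * gauss lam beta k x) N
    + s * sym_partial (fun k => b k * gauss lam beta k x) N)).
  - intros N. induction N as [|N IHN]; [rewrite !sym_partial_0; ring|].
    rewrite !sym_partial_S, <- IHN. ring.
  - apply is_lim_seq_plus'; [now apply is_lim_seq_gauss_sum|].
    apply (is_lim_seq_scal_l _ _ (Finite _)). now apply is_lim_seq_gauss_sum.
Qed.

(** [quad] carries no bound on the k a_k, so differentiability is read off the theta form. *)
Lemma ex_derive_gauss_sum (lam beta x : R) (a : Z -> R) : 0 < lam -> 0 < beta -> bseq a ->
  ex_derive (gauss_sum lam beta a) x.
Proof.
  intros Hlam Hbeta Ha.
  apply (ex_derive_ext (fun x => exp (- lam * x ^ 2) * (theta lam beta a (exp (2 * lam * beta * x))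
       + theta lam beta (fun k => a (- k)%Z) (exp (- (2 * lam * beta * x))) - a 0%Z))).
  { intros t. now rewrite gauss_sum_theta. }
  assert (H1 := is_derive_theta lam beta Hlam Hbeta a (exp (2 * lam * beta * x)) Ha).
  assert (H2 := is_derive_theta lam beta Hlam Hbeta _ (exp (- (2 * lam * beta * x))) (bseq_opp a Ha)).
  auto_derive. split; [|split; [|exact I]]; eexists; eassumption.
Qed.

Lemma quad_ex_derive (lam beta x : R) (u : R -> R) : 0 < lam -> 0 < beta ->
  quad lam beta u -> ex_derive u x.
Proof.
  intros Hlam Hbeta. induction 1 as [a b Ha Hb|u v _ IH1 _ IH2|c u _ IH|u v _ IH Huv].
  - apply ex_derive_mult; now apply ex_derive_gauss_sum.
  - now apply (ex_derive_plus u v).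
  - now apply ex_derive_scal.
  - now apply (ex_derive_ext u).
Qed.

Lemma nonzero_near (u : R -> R) (x0 : R) : ex_derive u x0 -> u x0 <> 0 ->
  exists l r, l < x0 < r /\ forall x, l < x < r -> u x <> 0.
Proof.
  intros Hu H0. apply ex_derive_continuous in Hu.
  destruct (Hu (fun y => y <> 0)) as [e He]; [now apply open_neq|].
  assert (He0 := cond_pos e).
  exists (x0 - e), (x0 + e). split; [lra|]. intros x Hx. apply He.
  unfold ball; simpl; unfold AbsRing_ball, abs, minus, plus, opp; simpl.
  apply Rabs_def1; lra.
Qed.

Section TwoSeries.
Context (lam beta : R) (Hlam : 0 < lam) (Hbeta : 0 < beta).

Let F := gauss_sum lam beta.
Let idx (a : Z -> R) := fun k => IZR k * a k.

Lemma quad_four (a1 b1 a2 b2 a3 b3 a4 b4 : Z -> R) :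
  bseq a1 -> bseq b1 -> bseq a2 -> bseq b2 -> bseq a3 -> bseq b3 -> bseq a4 -> bseq b4 ->
  quad lam beta (fun x => F a1 x * F b1 x + F a2 x * F b2 x - (F a3 x * F b3 x + F a4 x * F b4 x)).
Proof.
  intros. apply (quad_ext _ _ (fun x => (F a1 x * F b1 x + F a2 x * F b2 x)
     + (-1) * (F a3 x * F b3 x + F a4 x * F b4 x))); [|intros; ring].
  apply (quad_plus lam beta (fun x => F a1 x * F b1 x + F a2 x * F b2 x)
    (fun x => (-1) * (F a3 x * F b3 x + F a4 x * F b4 x))).
  - apply (quad_plus lam beta (fun x => F a1 x * F b1 x) (fun x => F a2 x * F b2 x)); now apply quad_prod.
  - apply (quad_scal lam beta (-1) (fun x => F a3 x * F b3 x + F a4 x * F b4 x)).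
    apply (quad_plus lam beta (fun x => F a3 x * F b3 x) (fun x => F a4 x * F b4 x)); now apply quad_prod.
Qed.

Lemma quad_two (a1 a2 : Z -> R) : bseq a1 -> bseq a2 ->
  quad lam beta (fun x => F a1 x ^ 2 + F a2 x ^ 2).
Proof.
  intros. apply (quad_ext _ _ (fun x => F a1 x * F a1 x + F a2 x * F a2 x)); [|intros; ring].
  apply (quad_plus lam beta (fun x => F a1 x * F a1 x) (fun x => F a2 x * F a2 x)); now apply quad_prod.
Qed.

(** Write f, g for the complex series of c, d and h_f, h_g for those with coefficients multiplied by
    the index. The hypotheses say |g| = |f| and h_g conj g = h_f conj f. Where f is nonzero, h_g / g
    = h_f / f, so g / f has derivative 0. *)
Lemma phase_constant (c1 c2 d1 d2 : Z -> R) :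
  bseq c1 -> bseq c2 -> bseq d1 -> bseq d2 ->
  bseq (idx c1) -> bseq (idx c2) -> bseq (idx d1) -> bseq (idx d2) ->
  (forall x, F d1 x ^ 2 + F d2 x ^ 2 = F c1 x ^ 2 + F c2 x ^ 2) ->
  (forall x, F d1 x * F (idx d1) x + F d2 x * F (idx d2) x
     = F c1 x * F (idx c1) x + F c2 x * F (idx c2) x) ->
  (forall x, F d1 x * F (idx d2) x - F d2 x * F (idx d1) x
     = F c1 x * F (idx c2) x - F c2 x * F (idx c1) x) ->
  exists p q, p ^ 2 + q ^ 2 = 1 /\
    forall x, F d1 x = p * F c1 x - q * F c2 x /\ F d2 x = p * F c2 x + q * F c1 x.
Proof.
  intros Hc1 Hc2 Hd1 Hd2 Hkc1 Hkc2 Hkd1 Hkd2 Hn Hdot Hdet.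
  destruct (classic (forall x, F c1 x ^ 2 + F c2 x ^ 2 = 0)) as [H0|H0].
  { exists 1, 0. split; [ring|]. intros x. specialize (H0 x). specialize (Hn x).
    assert (F c1 x = 0 /\ F c2 x = 0 /\ F d1 x = 0 /\ F d2 x = 0) as (E1 & E2 & E3 & E4)
      by (repeat split; nra).
    rewrite E1, E2, E3, E4. lra. }
  apply not_all_ex_not in H0. destruct H0 as [x0 H0].
  destruct (nonzero_near (fun x => F c1 x ^ 2 + F c2 x ^ 2) x0) as [l [r [Hx0 Hlr]]]; auto.
  { apply (quad_ex_derive lam beta); auto. now apply quad_two. }
  set (n := fun x => F c1 x ^ 2 + F c2 x ^ 2) in *.
  (* p + i q is g conj f / |f|^2, that is g / f. *)
  set (p := fun x => (F d1 x * F c1 x + F d2 x * F c2 x) / n x).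
  set (q := fun x => (F d2 x * F c1 x - F d1 x * F c2 x) / n x).
  assert (Hder : forall x, l < x < r -> is_derive p x 0 /\ is_derive q x 0).
  { intros x Hx. specialize (Hlr x Hx).
    assert (D1 := is_derive_gauss_sum lam beta Hlam Hbeta c1 x Hc1 Hkc1).
    assert (D2 := is_derive_gauss_sum lam beta Hlam Hbeta c2 x Hc2 Hkc2).
    assert (D3 := is_derive_gauss_sum lam beta Hlam Hbeta d1 x Hd1 Hkd1).
    assert (D4 := is_derive_gauss_sum lam beta Hlam Hbeta d2 x Hd2 Hkd2).
    specialize (Hn x). specialize (Hdot x). specialize (Hdet x).
    fold F in D1, D2, D3, D4. fold (idx c1) in D1. fold (idx c2) in D2.
    fold (idx d1) in D3. fold (idx d2) in D4.
    (* [N1] and [N2] are the real and imaginary parts of |g|^2 h_g = g (h_g conj g), rewritten with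
       the data of f. *)
    assert (N1 : n x * F (idx d1) x = F d1 x * (F c1 x * F (idx c1) x + F c2 x * F (idx c2) x)
       - F d2 x * (F c1 x * F (idx c2) x - F c2 x * F (idx c1) x)).
    { rewrite <- Hdot, <- Hdet. unfold n. rewrite <- Hn. ring. }
    assert (N2 : n x * F (idx d2) x = F d2 x * (F c1 x * F (idx c1) x + F c2 x * F (idx c2) x)
       + F d1 x * (F c1 x * F (idx c2) x - F c2 x * F (idx c1) x)).
    { rewrite <- Hdot, <- Hdet. unfold n. rewrite <- Hn. ring. }
    assert (M1 : F (idx d1) x = (F d1 x * (F c1 x * F (idx c1) x + F c2 x * F (idx c2) x)
       - F d2 x * (F c1 x * F (idx c2) x - F c2 x * F (idx c1) x)) / n x).
    { rewrite <- N1. field. exact Hlr. }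
    assert (M2 : F (idx d2) x = (F d2 x * (F c1 x * F (idx c1) x + F c2 x * F (idx c2) x)
       + F d1 x * (F c1 x * F (idx c2) x - F c2 x * F (idx c1) x)) / n x).
    { rewrite <- N2. field. exact Hlr. }
    assert (U : forall (f : R -> R) y v, is_derive f y v -> Derive (fun t : R => f t) y = v)
      by (intros f y v Hf; now apply is_derive_unique).
    unfold p, q, n in *.
    split; auto_derive; repeat split; try (eexists; eassumption); try exact Hlr;
    rewrite (U _ _ _ D1), (U _ _ _ D2), (U _ _ _ D3), (U _ _ _ D4), M1, M2; field;
    intros E; apply Hlr; rewrite <- E; ring. }
  assert (Hconst : forall x, l < x < r -> p x = p x0 /\ q x = q x0).
  { assert (Hc : forall f : R -> R, (forall x, l < x < r -> is_derive f x 0) ->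
      forall x, l < x < r -> f x = f x0).
    { intros f Hf x Hx. destruct (Rtotal_order x x0) as [H|[H|H]].
      - apply eq_is_derive; auto. intros t Ht; apply Hf; lra.
      - now rewrite H.
      - symmetry. apply eq_is_derive; auto. intros t Ht; apply Hf; lra. }
    intros x Hx; split; apply Hc; auto; intros t Ht; now apply Hder. }
  assert (Heq : forall x, l < x < r ->
    F d1 x = p x0 * F c1 x - q x0 * F c2 x /\ F d2 x = p x0 * F c2 x + q x0 * F c1 x).
  { intros x Hx. destruct (Hconst x Hx) as [<- <-]. specialize (Hlr x Hx).
    unfold p, q, n in *. split; field; exact Hlr. }
  assert (Hmod : p x0 ^ 2 + q x0 ^ 2 = 1).
  { assert (E : p x0 ^ 2 + q x0 ^ 2 = (F d1 x0 ^ 2 + F d2 x0 ^ 2) / n x0)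
      by (unfold p, q, n in *; field; exact H0).
    rewrite E, Hn. unfold n in *. field. exact H0. }
  exists (p x0), (q x0). split; [exact Hmod|].
  set (P := p x0) in *. set (Q := q x0) in *.
  (* |g - z f|^2 with z = P + i Q is again in [quad], so its vanishing spreads from the interval to
     the whole line. *)
  assert (Hz : forall x, F (fun k => (d1 k + - P * c1 k) + Q * c2 k) x ^ 2
     + F (fun k => (d2 k + - P * c2 k) + - Q * c1 k) x ^ 2 = 0).
  { apply (quad_zero_interval lam beta l r); auto; [|lra|].
    - apply quad_two; repeat apply bseq_lin; auto.
    - intros x Hx. destruct (Heq x Hx) as [E1 E2]. unfold F in *.
      rewrite !gauss_sum_lin, E1, E2 by (repeat apply bseq_lin; auto). ring. }
  intros x. specialize (Hz x). unfold F in *.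
  rewrite !gauss_sum_lin in Hz by (repeat apply bseq_lin; auto).
  assert (Hsq : forall a b : R, a ^ 2 + b ^ 2 = 0 -> a = 0 /\ b = 0) by (intros a b Hab; split; nra).
  apply Hsq in Hz. lra.
Qed.

Lemma modulus_determines (Gamma : R -> Prop) (c1 c2 d1 d2 : Z -> R) :
  (forall x0, rich_left (beta / 2) Gamma x0) ->
  bseq c1 -> bseq c2 -> bseq d1 -> bseq d2 ->
  bseq (idx c1) -> bseq (idx c2) -> bseq (idx d1) -> bseq (idx d2) ->
  (forall x, Gamma x -> F d1 x ^ 2 + F d2 x ^ 2 = F c1 x ^ 2 + F c2 x ^ 2) ->
  (forall x, Gamma x -> Derive (F d1) x ^ 2 + Derive (F d2) x ^ 2
     = Derive (F c1) x ^ 2 + Derive (F c2) x ^ 2) ->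
  (forall x, F d1 x ^ 2 + F d2 x ^ 2 = F c1 x ^ 2 + F c2 x ^ 2) /\
  (forall x, F d1 x * F (idx d1) x + F d2 x * F (idx d2) x
     = F c1 x * F (idx c1) x + F c2 x * F (idx c2) x) /\
  ((forall x, F d1 x * F (idx d2) x - F d2 x * F (idx d1) x
     = F c1 x * F (idx c2) x - F c2 x * F (idx c1) x) \/
   (forall x, F d1 x * F (idx d2) x - F d2 x * F (idx d1) x
     = - (F c1 x * F (idx c2) x - F c2 x * F (idx c1) x))).
Proof.
  intros HG Hc1 Hc2 Hd1 Hd2 Hkc1 Hkc2 Hkd1 Hkd2 Hn Hd.
  assert (D : forall a x, bseq a -> bseq (idx a) ->
    is_derive (F a) x (2 * lam * (beta * F (idx a) x - x * F a x))).
  { intros a x Ha Hka. now apply is_derive_gauss_sum. }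
  assert (Hzero : forall u, quad lam beta u -> (forall x, Gamma x -> u x = 0) -> forall x, u x = 0).
  { intros u Hu H0 x. now apply (quad_zero_rich lam beta x Gamma u). }
  assert (Hn' : forall x, F d1 x ^ 2 + F d2 x ^ 2 = F c1 x ^ 2 + F c2 x ^ 2).
  { intros x.
    assert (E : F d1 x * F d1 x + F d2 x * F d2 x - (F c1 x * F c1 x + F c2 x * F c2 x) = 0);
      [|lra].
    revert x. apply Hzero; [now apply quad_four|]. intros x Hx. specialize (Hn x Hx). lra. }
  assert (Hdot : forall x, F d1 x * F (idx d1) x + F d2 x * F (idx d2) x
     = F c1 x * F (idx c1) x + F c2 x * F (idx c2) x).
  { intros x.
    (* The derivative of |f|^2 contains Re (h_f conj f) and x |f|^2; comparing f with g isolates the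
       former. *)
    assert (T : forall a1 a2, bseq a1 -> bseq (idx a1) -> bseq a2 -> bseq (idx a2) ->
      is_derive (fun x => F a1 x ^ 2 + F a2 x ^ 2) x
       (4 * lam * (beta * (F a1 x * F (idx a1) x + F a2 x * F (idx a2) x)
         - x * (F a1 x ^ 2 + F a2 x ^ 2)))).
    { intros a1 a2 H1 H2 H3 H4. assert (E1 := D a1 x H1 H2). assert (E2 := D a2 x H3 H4).
      auto_derive; [repeat split; eexists; eassumption|].
      assert (U : forall (f : R -> R) y v, is_derive f y v -> Derive (fun t : R => f t) y = v)
        by (intros f y v Hf; now apply is_derive_unique).
      rewrite (U _ _ _ E1), (U _ _ _ E2). ring. }
    assert (T1 := T c1 c2 Hc1 Hkc1 Hc2 Hkc2).
    apply (is_derive_ext _ _ _ _ (fun x => eq_sym (Hn' x))) in T1.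
    apply is_derive_unique in T1.
    rewrite (is_derive_unique _ _ _ (T d1 d2 Hd1 Hkd1 Hd2 Hkd2)), Hn' in T1.
    assert (0 < lam * beta) by nra.
    apply (Rmult_eq_reg_l (lam * beta)); lra. }
  split; [exact Hn'|]. split; [exact Hdot|].
  assert (Hh : forall x, F (idx d1) x ^ 2 + F (idx d2) x ^ 2 = F (idx c1) x ^ 2 + F (idx c2) x ^ 2).
  { intros x.
    assert (E : F (idx d1) x * F (idx d1) x + F (idx d2) x * F (idx d2) x
      - (F (idx c1) x * F (idx c1) x + F (idx c2) x * F (idx c2) x) = 0); [|lra].
    revert x. apply Hzero; [now apply quad_four|]. intros x Hx. specialize (Hd x Hx).
    specialize (Hn' x). specialize (Hdot x).
    rewrite (is_derive_unique _ _ _ (D c1 x Hc1 Hkc1)), (is_derive_unique _ _ _ (D c2 x Hc2 Hkc2)),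
      (is_derive_unique _ _ _ (D d1 x Hd1 Hkd1)), (is_derive_unique _ _ _ (D d2 x Hd2 Hkd2)) in Hd.
    set (C1 := F c1 x) in *. set (C2 := F c2 x) in *. set (D1 := F d1 x) in *. set (D2 := F d2 x) in *.
    set (H1 := F (idx c1) x) in *. set (H2 := F (idx c2) x) in *.
    set (G1 := F (idx d1) x) in *. set (G2 := F (idx d2) x) in *.
    assert (E : (2 * lam * beta) ^ 2 * (G1 * G1 + G2 * G2 - (H1 * H1 + H2 * H2)) = 0).
    (* Expansion of |f'|^2 = (2 lam)^2 |beta h_f - x f|^2: the cross terms and the x^2 terms agree
       for f and g. *)
    { replace ((2 * lam * beta) ^ 2 * (G1 * G1 + G2 * G2 - (H1 * H1 + H2 * H2))) with
        (((2 * lam * (beta * G1 - x * D1)) ^ 2 + (2 * lam * (beta * G2 - x * D2)) ^ 2)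
         - ((2 * lam * (beta * H1 - x * C1)) ^ 2 + (2 * lam * (beta * H2 - x * C2)) ^ 2)
         + 8 * lam ^ 2 * beta * x * ((D1 * G1 + D2 * G2) - (C1 * H1 + C2 * H2))
         - 4 * lam ^ 2 * x ^ 2 * ((D1 ^ 2 + D2 ^ 2) - (C1 ^ 2 + C2 ^ 2))) by ring.
      rewrite Hd, Hdot, Hn'. ring. }
    apply Rmult_integral in E. destruct E as [E|E]; [|exact E].
    exfalso. revert E. apply pow_nonzero. apply Rgt_not_eq.
    repeat apply Rmult_lt_0_compat; lra. }
  set (A := fun x => F c1 x * F (idx c2) x - F c2 x * F (idx c1) x).
  set (B := fun x => F d1 x * F (idx d2) x - F d2 x * F (idx d1) x).
  (* Lagrange identity: the square of the determinant is |f|^2 |h_f|^2 minus the square of the real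
     part, so A^2 = B^2. *)
  assert (HAB : forall x, (A x - B x) * (A x + B x) = 0).
  { intros x. unfold A, B. specialize (Hn' x). specialize (Hdot x). specialize (Hh x).
    transitivity (((F c1 x ^ 2 + F c2 x ^ 2) * (F (idx c1) x ^ 2 + F (idx c2) x ^ 2)
       - (F c1 x * F (idx c1) x + F c2 x * F (idx c2) x) ^ 2)
      - ((F d1 x ^ 2 + F d2 x ^ 2) * (F (idx d1) x ^ 2 + F (idx d2) x ^ 2)
       - (F d1 x * F (idx d1) x + F d2 x * F (idx d2) x) ^ 2)); [ring|].
    rewrite Hn', Hdot, Hh. ring. }
  assert (Qm : quad lam beta (fun x => A x - B x)).
  { eapply quad_ext; [apply (quad_four c1 (idx c2) d2 (idx d1) c2 (idx c1) d1 (idx d2)); auto|].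
    intros x; unfold A, B; ring. }
  assert (Qp : quad lam beta (fun x => A x + B x)).
  { eapply quad_ext; [apply (quad_four c1 (idx c2) d1 (idx d2) c2 (idx c1) d2 (idx d1)); auto|].
    intros x; unfold A, B; ring. }
  (* If A - B is nonzero somewhere, it is nonzero on an interval, where A + B must vanish; then A +
     B vanishes everywhere. *)
  destruct (classic (forall x, A x - B x = 0)) as [H0|H0].
  - left. intros x. specialize (H0 x). unfold A, B in H0. lra.
  - right. apply not_all_ex_not in H0. destruct H0 as [x0 H0].
    destruct (nonzero_near _ x0 (quad_ex_derive lam beta x0 _ Hlam Hbeta Qm) H0) as [l [r [Hx0 Hlr]]].
    assert (HS : forall x, A x + B x = 0).
    { apply (quad_zero_interval lam beta l r); auto; [lra|]. intros x Hx.
      specialize (Hlr x Hx). destruct (Rmult_integral _ _ (HAB x)); [contradiction|assumption]. }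
    intros x. specialize (HS x). unfold A, B in HS. lra.
Qed.
End TwoSeries.

(** * Passage from complex series to real and imaginary parts *)

Lemma gauss_series_pair (lam beta x : R) (c : Z -> C) :
  gauss_series lam beta c x =
  (gauss_sum lam beta (fun k => fst (c k)) x, gauss_sum lam beta (fun k => snd (c k)) x).
Proof.
  unfold gauss_series, Zsum, gauss_sum. f_equal; f_equal; apply Lim_seq_ext; intros N;
  apply sym_partial_ext; intros k; unfold gauss, Cmult; simpl; ring.
Qed.

Lemma Cmod_eq_sq (a1 a2 b1 b2 : R) : Cmod (a1, a2) = Cmod (b1, b2) ->
  a1 ^ 2 + a2 ^ 2 = b1 ^ 2 + b2 ^ 2.
Proof.
  unfold Cmod; simpl. intros H. apply sqrt_inj in H; nra.
Qed.

Lemma bounded_seq_components (c : Z -> C) : bounded_seq c ->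
  bseq (fun k => fst (c k)) /\ bseq (fun k => snd (c k)).
Proof.
  intros [M HM]. split; exists M; intros k; eapply Rle_trans; try apply (HM k);
  (eapply Rle_trans; [|apply Rmax_Cmod]); [apply Rmax_l|apply Rmax_r].
Qed.

Lemma bounded_seq_index_components (c : Z -> C) :
  bounded_seq (fun k => Cmult (RtoC (IZR k)) (c k)) ->
  bseq (fun k => IZR k * fst (c k)) /\ bseq (fun k => IZR k * snd (c k)).
Proof.
  intros H. apply bounded_seq_components in H. destruct H as [[M1 H1] [M2 H2]].
  split; [exists M1|exists M2]; intros k; [specialize (H1 k)|specialize (H2 k)]; simpl in *.
  - now rewrite Rmult_0_l, Rminus_0_r in H1.
  - now rewrite Rmult_0_l, Rplus_0_r in H2.
Qed.

Theorem theorem3p1 (beta lambda : R) (Gamma : R -> Prop) (c d : Z -> C) :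
  0 < beta -> 0 < lambda ->
  separated Gamma ->
  Rbar_lt (Finite (2 / beta)) (lower_beurling_density Gamma) ->
  bounded_seq c -> bounded_seq (fun k => Cmult (RtoC (IZR k)) (c k)) ->
  bounded_seq d -> bounded_seq (fun k => Cmult (RtoC (IZR k)) (d k)) ->
  (forall gamma : R, Gamma gamma ->
     Cmod (gauss_series lambda beta d gamma) = Cmod (gauss_series lambda beta c gamma) /\
     Cmod (Cderive (gauss_series lambda beta d) gamma)
       = Cmod (Cderive (gauss_series lambda beta c) gamma)) ->
  exists z : C, Cmod z = 1 /\
    ((forall x : R, gauss_series lambda beta d x = Cmult z (gauss_series lambda beta c x)) \/
     (forall x : R, gauss_series lambda beta d x = Cmult z (Cconj (gauss_series lambda beta c x)))).
Proof.
  intros Hbeta Hlam _ HD Hc Hkc Hd Hkd HG.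
  apply bounded_seq_components in Hc, Hd. apply bounded_seq_index_components in Hkc, Hkd.
  destruct Hc as [Hc1 Hc2], Hd as [Hd1 Hd2], Hkc as [Hkc1 Hkc2], Hkd as [Hkd1 Hkd2].
  set (c1 := fun k => fst (c k)) in *. set (c2 := fun k => snd (c k)) in *.
  set (d1 := fun k => fst (d k)) in *. set (d2 := fun k => snd (d k)) in *.
  assert (Ec : forall x, gauss_series lambda beta c x
    = (gauss_sum lambda beta c1 x, gauss_sum lambda beta c2 x)) by exact (fun x => gauss_series_pair lambda beta x c).
  assert (Ed : forall x, gauss_series lambda beta d x
    = (gauss_sum lambda beta d1 x, gauss_sum lambda beta d2 x)) by exact (fun x => gauss_series_pair lambda beta x d).
  assert (Edc : forall x, Cderive (gauss_series lambda beta c) x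
    = (Derive (gauss_sum lambda beta c1) x, Derive (gauss_sum lambda beta c2) x)).
  { intros x. unfold Cderive. f_equal; apply Derive_ext; intros t; now rewrite Ec. }
  assert (Edd : forall x, Cderive (gauss_series lambda beta d) x
    = (Derive (gauss_sum lambda beta d1) x, Derive (gauss_sum lambda beta d2) x)).
  { intros x. unfold Cderive. f_equal; apply Derive_ext; intros t; now rewrite Ed. }
  destruct (modulus_determines lambda beta Hlam Hbeta Gamma c1 c2 d1 d2) as [Hn [Hdot Hdet]]; auto.
  (* Products of series of step beta have step beta / 2, whose critical density is 2 / beta. *)
  { intros x0. apply rich_left_density; [lra|].
    replace (/ (beta / 2)) with (2 / beta) by (field; lra). exact HD. }
  { intros x Hx. destruct (HG x Hx) as [H _]. rewrite Ec, Ed in H. now apply Cmod_eq_sq. }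
  { intros x Hx. destruct (HG x Hx) as [_ H]. rewrite Edc, Edd in H. now apply Cmod_eq_sq. }
  assert (Hz : forall p q : R, p ^ 2 + q ^ 2 = 1 -> Cmod (p, q) = 1).
  { intros p q H. unfold Cmod; simpl fst; simpl snd. rewrite H. apply sqrt_1. }
  destruct Hdet as [Hdet|Hdet].
  - destruct (phase_constant lambda beta Hlam Hbeta c1 c2 d1 d2) as [p [q [Hpq H]]]; auto.
    exists (p, q). split; [now apply Hz|]. left. intros x. destruct (H x) as [E1 E2].
    rewrite Ec, Ed, E1, E2. reflexivity.
  (* The imaginary coefficients of conj g, with - d2 written as d2 - 2 d2 so that [bseq_lin] and
     [gauss_sum_lin] apply. Conjugation flips the sign of the determinant. *)
  - set (e2 := fun k => d2 k + -2 * d2 k).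
    assert (Ee : forall x, gauss_sum lambda beta e2 x = - gauss_sum lambda beta d2 x).
    { intros x. unfold e2. rewrite gauss_sum_lin by auto. ring. }
    assert (Hke2 : bseq (fun k => IZR k * d2 k + -2 * (IZR k * d2 k))) by now apply bseq_lin.
    assert (Eke : forall x, gauss_sum lambda beta (fun k => IZR k * e2 k) x
       = - gauss_sum lambda beta (fun k => IZR k * d2 k) x).
    { intros x. transitivity (gauss_sum lambda beta (fun k => IZR k * d2 k + -2 * (IZR k * d2 k)) x).
      - unfold gauss_sum. f_equal. apply Lim_seq_ext. intros N. apply sym_partial_ext.
        intros k. unfold e2. ring.
      - rewrite gauss_sum_lin by auto. ring. }
    destruct (phase_constant lambda beta Hlam Hbeta c1 c2 d1 e2) as [p [q [Hpq H]]]; auto.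
    + now apply bseq_lin.
    + destruct Hke2 as [M HM]. exists M. intros k.
      replace (IZR k * e2 k) with (IZR k * d2 k + -2 * (IZR k * d2 k)) by (unfold e2; ring).
      apply HM.
    + intros x. rewrite Ee, <- Hn. ring.
    + intros x. rewrite Ee, Eke, <- Hdot. ring.
    + intros x. rewrite Ee, Eke. specialize (Hdet x). lra.
    (* From conj g = (p + i q) f follows g = (p - i q) conj f. *)
    + exists (p, - q). split; [apply Hz; rewrite <- Hpq; ring|]. right. intros x.
      destruct (H x) as [E1 E2]. rewrite Ee in E2. rewrite Ec, Ed, E1.
      unfold Cmult, Cconj; simpl. f_equal; lra.
Qed.
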